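(* Let $H$ be a separable Hilbert space and let $A$ be a positive self-adjoint operator in $H$ having a complete orthonormal system of eigenfunctions $\{v_k\}$ in $H$ with eigenvalues $0<\lambda_1\le\lambda_2\le\cdots$ (so $Av_k=\lambda_kv_k$). Let $\rho\in(0,1)$ and $T>0$. Then for any $\varphi\in H$ the problem $$ \partial_t^\rho u(t)+Au(t)=0,\quad 0<t\le T;\qquad \lim_{t\to 0}\partial_t^{\rho-1}u(t)=\varphi $$ has a unique solution, and this solution has the form $$ u(t)=\sum_{k=1}^\infty t^{\rho-1}E_{\rho,\rho}(-\lambda_kt^\rho)\,(\varphi,v_k)\,v_k . $$
   Context: $(\cdot,\cdot)$ and $\|\cdot\|$ denote the scalar product and norm of $H$. Integrals and derivatives of $H$-valued functions are understood in the strong sense. For $\sigma<0$, the fractional integral of order $\sigma$ of a function $h$ with values in $H$ is $$\partial_t^{\sigma}h(t)=\frac{1}{\Gamma(-\sigma)}\int_0^t\frac{h(\xi)}{(t-\xi)^{\sigma+1}}\,d\xi,\quad t>0,$$ provided the right-hand side exists. For $0<\rho<1$ the Riemann-Liouville fractional derivative of order $\rho$ is $\partial_t^\rho h(t)=\frac{d}{dt}\partial_t^{\rho-1}h(t)$. The Mittag-Leffler function is $E_{\rho,\mu}(t)=\sum_{k=0}^\infty \frac{t^k}{\Gamma(\rho k+\mu)}$. $C((a,b);H)$ denotes the set of continuous functions on $(a,b)$ with values in $H$ (similarly for half-open intervals). A solution of the problem is a function $u(t)$ such that $\partial_t^\rho u(t),\,Au(t)\in C((0,T];H)$ and such that the equation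 and the initial condition of the problem are satisfied. *)

(* Defs.v *)
From HB Require Import structures.
From mathcomp Require Import all_boot all_order all_algebra sesquilinear.
From mathcomp Require Import complex.
From mathcomp Require Import all_classical all_reals all_analysis.

Set Implicit Arguments.
Unset Strict Implicit.
Unset Printing Implicit Defensive.

Import Order.TTheory GRing.Theory Num.Theory.
Import numFieldNormedType.Exports.

Local Open Scope classical_set_scope.
Local Open Scope ring_scope.

(* The source does not say whether the Hilbert space is real or complex; the
   scalar field is a parameter that is literally R or R[i]. *)
Inductive scalar_kind := RealScalars | ComplexScalars.

Definition scalars (R : realType) (k : scalar_kind) : numFieldType :=
  match k with
  | RealScalars => R
  | ComplexScalars => R[i]
  end.

Definition scalar_of_real (R : realType) (k : scalar_kind) :
    R -> scalars R k :=
  match k with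
  | RealScalars => id
  | ComplexScalars => fun x => real_complex R x
  end.

Definition scalar_re (R : realType) (k : scalar_kind) : scalars R k -> R :=
  match k with
  | RealScalars => id
  | ComplexScalars => @complex.Re R
  end.

Definition scalar_conj (R : realType) (k : scalar_kind) :
    scalars R k -> scalars R k :=
  match k with
  | RealScalars => idfun
  | ComplexScalars => @conjc R
  end.

Arguments scalar_of_real {R} k x.
Arguments scalar_re {R} k z.
Arguments scalar_conj {R} k z.

Section HilbertSpace.
Context {R : realType} {k : scalar_kind} {H : completeNormedModType (scalars R k)}.
Local Notation K := (scalars R k).
Local Notation "x %:K" := (scalar_of_real k x) (at level 2, format "x %:K").

(* The norm of H takes its values in K; this is the same norm as a real. *)
Definition rnorm (x : H) : R := scalar_re k `|x|.

(* Together with the completeness of H, this makes H a Hilbert space. The form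
   is linear in its first argument. *)
Definition is_scalar_product (ip : {dot H for scalar_conj k}) :=
  forall x : H, ip x x = `|x| ^+ 2.

Definition separable_space := exists2 D : set H, countable D & dense D.

Definition lin_span (v : nat -> H) : set H :=
  [set x | exists n (c : 'I_n -> K), x = \sum_(i < n) c i *: v i].

Definition complete_orthonormal_system
    (ip : {dot H for scalar_conj k}) (v : nat -> H) :=
  (forall i j, ip (v i) (v j) = (i == j)%:R) /\ dense (lin_span v).

(* The value of [op_fun] outside [op_dom] is irrelevant. *)
Record linear_operator := LinearOperator {
  op_dom : set H;
  op_fun :> H -> H;
  op_dom0 : op_dom 0;
  op_dom_lin : forall (a : K) x y,
    op_dom x -> op_dom y -> op_dom (a *: x + y);
  op_fun_lin : forall (a : K) x y,
    op_dom x -> op_dom y -> op_fun (a *: x + y) = a *: op_fun x + op_fun y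
}.

(* [adjoint_graph ip A y z]: y is in the domain of the adjoint of A, which maps
   y to z (z is unique as soon as A is densely defined). *)
Definition adjoint_graph (ip : {dot H for scalar_conj k})
    (A : linear_operator) (y z : H) :=
  forall x, op_dom A x -> ip (A x) y = ip x z.

Definition self_adjoint (ip : {dot H for scalar_conj k})
    (A : linear_operator) :=
  dense (op_dom A) /\
  forall y z, adjoint_graph ip A y z <-> (op_dom A y /\ z = A y).

Definition positive_operator (ip : {dot H for scalar_conj k})
    (A : linear_operator) :=
  forall x, op_dom A x -> x != 0 -> 0 < ip (A x) x.

(* The Bochner integral: integrable simple functions are finite sums of
   vectors times indicators of measurable sets of finite measure (which may
   overlap). *)
Section Bochner.
Context {d : measure_display} {X : measurableType d}.
Variable mu : {measure set X -> \bar R}.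

Record simple_map := SimpleMap {
  sm_size : nat;
  sm_set : 'I_sm_size -> set X;
  sm_val : 'I_sm_size -> H;
  sm_measurable : forall i, measurable (sm_set i);
  sm_finite : forall i, (mu (sm_set i) < +oo)%E
}.

Arguments sm_set : clear implicits.
Arguments sm_val : clear implicits.

Definition sm_fun (s : simple_map) (x : X) : H :=
  \sum_i (\1_(sm_set s i) x : K) *: sm_val s i.

Definition sm_integral (D : set X) (s : simple_map) : H :=
  \sum_i (fine (mu (sm_set s i `&` D)))%:K *: sm_val s i.

(* The a.e. convergence is the strong measurability of f on D. *)
Definition is_bochner_integral (D : set X) (f : X -> H) (v : H) :=
  exists s : nat -> simple_map,
    [/\ {ae mu, forall x, D x -> (fun n => sm_fun (s n) x) @ \oo --> f x},
        (fun n => \int[mu]_(x in D) (rnorm (f x - sm_fun (s n) x))%:E)%E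
          @ \oo --> 0%E
      & (fun n => sm_integral D (s n)) @ \oo --> v].

Definition bochner_integrable (D : set X) (f : X -> H) :=
  exists v, is_bochner_integral D f v.

Definition bochner_integral (D : set X) (f : X -> H) : H :=
  xget 0 [set v | is_bochner_integral D f v].

End Bochner.

(* For a positive argument. *)
Definition Gamma (z : R) : R :=
  \int[lebesgue_measure]_(t in `]0, +oo[) (t `^ (z - 1) * expR (- t)).

(* For rho > 0 and mu > 0, so that Gamma only has positive arguments. *)
Definition mittag_leffler (rho mu t : R) : R :=
  limn (series (fun j : nat => t ^+ j / Gamma (rho * j%:R + mu))).

Definition frac_integrand (sigma : R) (h : R -> H) (t xi : R) : H :=
  ((t - xi) `^ (sigma + 1))^-1%:K *: h xi.

Definition frac_integrable (sigma : R) (h : R -> H) (t : R) :=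
  bochner_integrable lebesgue_measure `]0, t[ (frac_integrand sigma h t).

(* For sigma < 0; meaningful when [frac_integrable sigma h t]. *)
Definition frac_integral (sigma : R) (h : R -> H) (t : R) : H :=
  (Gamma (- sigma))^-1%:K *:
    bochner_integral lebesgue_measure `]0, t[ (frac_integrand sigma h t).

(* Derivatives in the norm of H of functions defined on I only: at an end point
   of I that belongs to I the derivative is one-sided. *)
Definition diff_quotient (F : R -> H) (t s : R) : H :=
  (s - t)^-1%:K *: (F s - F t).

Definition derivable_on (I : set R) (F : R -> H) (t : R) :=
  cvg (diff_quotient F t @ within I t^').

Definition derivative_on (I : set R) (F : R -> H) (t : R) : H :=
  lim (diff_quotient F t @ within I t^').

(* The Riemann-Liouville derivative of order rho in (0,1) of a function on I. *)
Definition has_frac_derivative (I : set R) (rho : R) (h : R -> H) :=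
  forall t, I t ->
    frac_integrable (rho - 1) h t /\
    derivable_on I (frac_integral (rho - 1) h) t.

Definition frac_derivative (I : set R) (rho : R) (h : R -> H) (t : R) : H :=
  derivative_on I (frac_integral (rho - 1) h) t.

(* Only the values of u on ]0, T] matter. *)
Record is_solution (A : linear_operator) (rho T : R) (phi : H)
    (u : R -> H) : Prop := IsSolution {
  sol_frac_derivative : has_frac_derivative `]0, T] rho u;
  sol_frac_derivative_cont :
    {within `]0, T], continuous (frac_derivative `]0, T] rho u)};
  sol_dom : forall t : R, 0 < t <= T -> op_dom A (u t);
  sol_op_cont : {within `]0, T], continuous (fun t : R => A (u t))};
  sol_equation : forall t : R, 0 < t <= T ->
    frac_derivative `]0, T] rho u t + A (u t) = 0;
  sol_initial : frac_integral (rho - 1) u t @[t --> 0^'+] --> phi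
}.

End HilbertSpace.

Arguments linear_operator {R k} H.
Arguments separable_space {R k} H.

(* Main.v *)
(* Expanding in the eigenvectors, the candidate solution has the j-th coordinate
   e(t) (phi, v_j) with e(t) = t^(rho-1) E_{rho,rho}(- lambda t^rho), lambda =
   lambda_j. The kernels e satisfy the resolvent (Volterra) identity
   e(t) + lambda (t^(rho-1) / Gamma(rho)) * e = t^(rho-1) / Gamma(rho), their
   fractional integral of order rho - 1 is E(t) = E_{rho,1}(- lambda t^rho), and
   E' = - lambda e. The crucial point is that e is positive: the kernel t^(rho-1)
   is log-convex, so e cannot reach a first zero. Hence E is nonincreasing with
   values in [0, 1], e(t) <= t^(rho-1) / Gamma(rho) and lambda e(t) <= 1 / t.
   These bounds are uniform in lambda; since the terms of the series are
   orthogonal, uniform bounds and pointwise convergence of the multipliers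
   suffice for every limit that is taken in H. Testing the difference of two
   solutions against v_j gives a scalar homogeneous equation, which only has the
   zero solution by a maximum principle for the fractional derivative. *)
From HB Require Import structures.
Require Import Defs.
From mathcomp Require Import all_boot all_order all_algebra sesquilinear complex.
From mathcomp Require Import all_classical all_reals all_analysis.
From mathcomp Require Import measurable_realfun.
From mathcomp Require Import lra ring.

Set Implicit Arguments.
Unset Strict Implicit.
Unset Printing Implicit Defensive.

Import Order.TTheory GRing.Theory Num.Theory.
Import numFieldNormedType.Exports.

Local Open Scope classical_set_scope.
Local Open Scope ring_scope.

(** * The Gamma and Beta integrals *)

(** The eigenvalues may be unbounded, and the power series only bounds e(t) by a quantity that grows
    with lambda t^rho. The series is therefore used for one fixed lambda at a time (integrability,
    termwise convolution), while every estimate that is summed over the eigenvalues rests on the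
    positivity of e. The bound 1 / t for lambda e(t) is not integrable at 0, so A u is never
    integrated up to 0. The fractional integral of u is differentiated through the difference
    quotients of E instead, which are bounded uniformly on [t/2, oo[. Real and complex scalars are
    treated alike through the real part of the scalar product: testing against c v_j with arbitrary
    scalars c recovers the full coordinate. The value of a Bochner integral is a choice among
    admissible limits, and these real coordinates also identify it. For uniqueness, a solution is
    controlled near 0 only by the integrability of its fractional integrand and by the initial
    condition, and it lives on ]0, T] only. A maximum argument needs no more than this, unlike a
    transform on the half-line. *)

Section affine.
Context {R : realType}.
Notation mu := (@lebesgue_measure R).
Local Open Scope ereal_scope.

(** The right-hand side is a scaled pushforward, hence a measure in [A]; it agrees with the length
    on the intervals ]a, b], which determine the Lebesgue measure. *)
Lemma lebesgue_measure_affine (c d : R) (A : set R) : (0 < c)%R ->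
  measurable A ->
  lebesgue_measure A =
  c%:E * lebesgue_measure ((fun x => c * x + d)%R @^-1` A).
Proof.
move=> c0 mA.
pose h := (fun x : measurableTypeR R => c * x + d : measurableTypeR R)%R.
have mh : measurable_fun setT h.
  by apply: measurable_funD => //; apply: measurable_funM.

pose c' : {nonneg R} := NngNum (ltW c0).
pose m := mscale c' (measure_function_pushforward__canonical__measure_function_Measure mu mh).
rewrite -[RHS]/(m A).
apply: lebesgue_measure_unique mA => _ [[a b]] /= _ <-.
rewrite /m /mscale/= /pushforward/=.
have -> : h @^-1` `]a, b]%classic = `]((a - d) / c)%R, ((b - d) / c)%R]%classic.
  apply/seteqP; split => x /=; rewrite !in_itv/= /h;
  by rewrite ltr_pdivrMr// ler_pdivlMr// ltrBlDr lerBrDr mulrC.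
rewrite !lebesgue_measure_itv/= !lte_fin ltr_pM2r ?invr_gt0// ltrD2r.
case: ifPn; rewrite ?mule0// => ab.
rewrite -!EFinD -EFinM; congr EFin.
by field; rewrite gt_eqF.
Qed.

(** Serves for the scalings (d = 0) and the translations (c = 1) that bring convolution integrals to
    a standard interval. *)
Lemma ge0_integral_affine (c d : R) (D : set R) (f : R -> \bar R) :
  (0 < c)%R -> measurable D -> measurable_fun D f ->
  (forall x, D x -> 0 <= f x) ->
  \int[mu]_(x in D) f x =
  c%:E * \int[mu]_(x in (fun x => c * x + d)%R @^-1` D) f (c * x + d)%R.
Proof.
move=> c0 mD mf f0.
pose h := (fun x : measurableTypeR R => c * x + d : measurableTypeR R)%R.
have mh : measurable_fun setT h.
  by apply: measurable_funD => //; apply: measurable_funM.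

pose c' : {nonneg R} := NngNum (ltW c0).
pose m := mscale c' (measure_function_pushforward__canonical__measure_function_Measure mu mh).
rewrite (@eq_measure_integral _ _ _ _ m); last first.
  by move=> A mA _; exact: (lebesgue_measure_affine d c0 mA).
rewrite ge0_integral_mscale//= ge0_integral_pushforward//.
by move=> y; rewrite inE; exact: f0.
Qed.

End affine.

Section power_integral.
Context {R : realType}.
Notation mu := (@lebesgue_measure R).

Lemma FTC2_is_derive (f F : R -> R) (a b : R) : a < b ->
  (forall x, a <= x <= b -> is_derive x 1 F (f x)) ->
  (forall x, a <= x <= b -> {for x, continuous f}) ->
  (\int[mu]_(x in `[a, b]) (f x)%:E = (F b)%:E - (F a)%:E)%E.
Proof.
move=> ab dF cf.
have cF x : a <= x <= b -> {for x, continuous F}.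
  move=> /dF [dFx _].
  by apply: differentiable_continuous; exact/derivable1_diffP.
apply: continuous_FTC2 => //.
- apply: continuous_in_subspaceT => x; rewrite inE/= in_itv/=; exact: cf.
- split.
  + by move=> x; rewrite in_itv/= => /andP[/ltW ax /ltW xb]; apply: ex_derive;
      apply: dF; rewrite ax.
  + by apply: cvg_at_right_filter; apply: cF; rewrite lexx ltW.
  + by apply: cvg_at_left_filter; apply: cF; rewrite lexx ltW.
- move=> x; rewrite in_itv/= => /andP[/ltW ax /ltW xb].
  by rewrite derive1E; apply: derive_val; apply: dF; rewrite ax.
Qed.

Lemma continuous_powR (a x : R) : 0 < x -> {for x, continuous (@powR R ^~ a)}.
Proof.
move=> x0; apply: differentiable_continuous; apply/derivable1_diffP.
by apply: derivable_powR; rewrite in_itv/= x0.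
Qed.

Local Open Scope ereal_scope.

(** For a < 1 the integrand is singular at 0. The primitive x^a / a bounds the integrals over
    [1/(n+1), 1] by 1 / a, and monotone convergence passes to ]0, 1]. *)
Lemma integral_powR01_lty (a : R) : (0 < a)%R ->
  \int[mu]_(x in `]0%R, 1%R]) (x `^ (a - 1))%:E < +oo.
Proof.
move=> a0.
have cvg_int := @ge0_nondecreasing_set_cvg_integral _ (measurableTypeR R) R
  (fun n => `[(n.+1%:R^-1)%R, 1%R]%classic) (fun x => (x `^ (a - 1))%:E) mu.
have U : \bigcup_i `[(i.+1%:R^-1)%R, 1%R]%classic = `]0%R, 1%R]%classic :> set R.
  apply/seteqP; split => x /=.
    move=> [n _] /=; rewrite !in_itv/= => /andP[nx ->].
    by rewrite andbT (lt_le_trans _ nx).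
  rewrite in_itv/= => /andP[x0 x1].
  exists (Num.truncn x^-1) => //=; rewrite in_itv/= x1 andbT.
  rewrite -[leRHS]invrK lef_pV2 ?posrE ?invr_gt0//.
  by rewrite ltW// truncnS_gt.
rewrite U in cvg_int.
apply: (@le_lt_trans _ _ (a^-1)%:E); last by rewrite ltry.
have {}cvg_int : \int[mu]_(x in `[(n.+1%:R^-1)%R, 1%R]%classic) (x `^ (a - 1))%:E
    @[n --> \oo] --> \int[mu]_(x in `]0%R, 1%R]) (x `^ (a - 1))%:E.
  apply: cvg_int => //.
  - apply/nondecreasing_seqP => n; rewrite subsetEset.
    by apply: subset_itvr; rewrite bnd_simp lef_pV2 ?posrE// ler_nat.
  - move=> n; apply/measurable_EFinP; apply: measurable_funTS.
    exact: measurable_powR.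
  - by move=> n x _; rewrite lee_fin powR_ge0.
rewrite -(cvg_lim _ cvg_int)//; apply: lime_le; first exact: cvgP cvg_int.
(* For n = 0 the interval is the point 1, to which the fundamental theorem of calculus does not
   apply. *)
apply: nearW => -[|n]; first by rewrite invr1 set_itv1 integral_set1 lee_fin invr_ge0 ltW.
have n1 : (n.+2%:R^-1 < 1 :> R)%R by rewrite invf_lt1// ltr1n.
have pos x : (n.+2%:R^-1 <= x <= 1 -> 0 < x :> R)%R.
  by move=> /andP[+ _]; apply: lt_le_trans.
have -> : \int[mu]_(x in `[(n.+2%:R^-1)%R, 1%R]) (x `^ (a - 1))%:E =
    (a^-1 * 1 `^ a)%:E - (a^-1 * n.+2%:R^-1 `^ a)%:E.
  apply: (FTC2_is_derive (F := (fun x => a^-1 * x `^ a)%R)) => // x /pos x0.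
    have d := is_derive1_powR a x0.
    apply: is_derive_eq; rewrite /GRing.scale/= mulKf//.
    by rewrite gt_eqF.
  exact: continuous_powR.
rewrite powR1 mulr1 -EFinD lee_fin gerBl mulr_ge0 ?powR_ge0//.
by rewrite invr_ge0 ltW.
Qed.
End power_integral.

Section gamma.
Context {R : realType}.
Notation mu := (@lebesgue_measure R).

(** Up to the factor c, this is the total mass 1 of the exponential distribution. *)
Lemma integral_expR (c : R) : 0 < c ->
  (\int[mu]_(x in `]0%R, +oo[) (expR (- c * x))%:E = (c^-1)%:E)%E.
Proof.
move=> c0.
have m D : measurable_fun D (fun x : R => (expR (- c * x))%:E).
  by apply/measurable_EFinP; apply: measurable_funTS; apply: measurableT_comp.
rewrite -[LHS]mul1e -(divff (lt0r_neq0 c0)) mulrC EFinM -muleA.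
rewrite -ge0_integralZl//; last 2 first.
- exact: m.
- by rewrite lee_fin ltW.
- rewrite integral_itv_obnd_cbnd; last by apply: measurable_funeM; exact: m.
  rewrite -[RHS]mule1 -(integral_exponential_pdf c0).
  congr (_ * _)%E; rewrite integral_mkcond; apply: eq_integral => x _.
  by rewrite /exponential_pdf !patchE; case: ifP.
Qed.

Definition gamma_integrand (a x : R) : R := x `^ (a - 1) * expR (- x).

Lemma gamma_integrand_ge0 (a x : R) : 0 <= gamma_integrand a x.
Proof. by rewrite mulr_ge0 ?powR_ge0 ?expR_ge0. Qed.

Lemma measurable_gamma_integrand (a : R) (D : set R) :
  measurable_fun D (gamma_integrand a).
Proof.
apply: measurable_funTS; apply: measurable_funM; first exact: measurable_powR.
exact: measurableT_comp.
Qed.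

Lemma gamma_integral_lty (a : R) : 0 < a ->
  (\int[mu]_(x in `]0%R, +oo[) (gamma_integrand a x)%:E < +oo)%E.
Proof.
move=> a0.
have mE D : measurable_fun D (EFin \o gamma_integrand a).
  by apply/measurable_EFinP; exact: measurable_gamma_integrand.
rewrite (@itv_bndbnd_setU _ _ _ (BRight 1%R)) ?bnd_simp//.
rewrite ge0_integral_setU//=; last 3 first.
- exact: mE.
- by move=> x _; rewrite lee_fin gamma_integrand_ge0.
- by apply/disj_set2P; rewrite -subset0 => x [] /=;
    rewrite !in_itv/= andbT => /andP[_ +] => /le_lt_trans /[apply]; rewrite ltxx.
apply: lte_add_pinfty.
- apply: le_lt_trans (integral_powR01_lty a0).
  apply: ge0_le_integral => //.
  + by move=> x _; rewrite lee_fin gamma_integrand_ge0.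
  + exact: mE.
  + apply/measurable_EFinP; apply: measurable_funTS; exact: measurable_powR.
  + move=> x /=; rewrite in_itv/= => /andP[x0 x1].
    rewrite lee_fin ler_piMr ?powR_ge0// expR_le1 oppr_le0; exact: ltW.
(* The inequality exp y >= y^(n+1) / (n+1)! at y = x / 2 gives x^(n+1) <= C exp(x / 2), and n + 1 >
   a gives x^(a-1) <= x^(n+1) for x > 1. Half of the exponential decay is left over. *)
- pose n := Num.truncn a.
  pose C : R := n.+1`!%:R * 2 ^+ n.+1.
  have C0 : 0 <= C by rewrite mulr_ge0.
  apply: (@le_lt_trans _ _
    (\int[mu]_(x in `]1%R, +oo[) (C%:E * (expR (- 2^-1 * x))%:E))%E).
    apply: ge0_le_integral => //.
    + by move=> x _; rewrite lee_fin gamma_integrand_ge0.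
    + exact: mE.
    + apply/measurable_EFinP; apply: measurable_funTS.
      by apply: measurable_funM => //; apply: measurableT_comp => //.
    + move=> x /=; rewrite in_itv/= andbT => x1.
      have x0 : 0 < x by apply: lt_trans x1.
      rewrite -EFinM lee_fin /gamma_integrand.
      have -> : expR (- x) = expR (2^-1 * - x) * expR (- 2^-1 * x).
        by rewrite -expRD; congr expR; field.
      rewrite mulrA ler_wpM2r ?expR_ge0//.
      have le1 : x `^ (a - 1) <= x ^+ n.+1.
        rewrite -powR_mulrn ?(ltW x0)//; apply: ler_powR; first exact: ltW.
        by rewrite (le_trans (_ : _ <= a)) ?gerBl// ltW// truncnS_gt.
      have le2 : x ^+ n.+1 <= C * expR (x / 2).
        have /(expR_ge1Dxn n) : 0 <= x / 2 by rewrite divr_ge0// ltW.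
        move=> /(le_trans _); move/(_ ((x / 2) ^+ n.+1 / (n.+1)`!%:R)).
        rewrite lerDr ler01 => /(_ isT); rewrite ler_pdivrMr ?ltr0n ?fact_gt0//.
        rewrite expr_div_n ler_pdivrMr ?exprn_gt0// => /le_trans; apply.
        by rewrite /C -mulrA mulrC mulrAC.
      rewrite (le_trans (ler_wpM2r (expR_ge0 _) (le_trans le1 le2)))//.
      by rewrite -mulrA -expRD mulrN mulrC mulrC [x / 2]mulrC subrr expR0 mulr1.
  rewrite ge0_integralZl//; last first.
    apply/measurable_EFinP; apply: measurable_funTS.
    exact: measurableT_comp.
  apply: (@le_lt_trans _ _ (C%:E * (2^-1^-1)%:E)%E); last by rewrite -EFinM ltry.
  apply: lee_wpmul2l; first by rewrite lee_fin.
  rewrite -integral_expR//; apply: ge0_subset_integral => //.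
  + apply/measurable_EFinP; apply: measurable_funTS.
    by apply: measurableT_comp => //.
  + by apply: subset_itvr; rewrite bnd_simp.
Qed.

Lemma EFin_Gamma (a : R) : 0 < a ->
  (Gamma a)%:E = (\int[mu]_(x in `]0%R, +oo[) (gamma_integrand a x)%:E)%E.
Proof.
move=> a0; rewrite /Gamma /Rintegral fineK//.
rewrite ge0_fin_numE; first exact: gamma_integral_lty.
by apply: integral_ge0 => x _; rewrite lee_fin gamma_integrand_ge0.
Qed.

Lemma Gamma1 : Gamma 1 = 1 :> R.
Proof.
apply: EFin_inj; rewrite EFin_Gamma// -[in RHS]invr1 -integral_expR//.
apply: eq_integral => x; rewrite inE/= in_itv/= andbT => x0.
by rewrite /gamma_integrand subrr powRr0 mul1r mulN1r.
Qed.

(** Only the part of the integral over [M, M + 1] is kept, where x^(a-1) = x^a / x >= M^a / (M + 1).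
    Since M is free, Gamma outgrows every geometric sequence; this replaces Stirling's formula. *)
Lemma Gamma_lower_bound (a M : R) : 0 < a -> 0 < M ->
  M `^ a * (expR (- (M + 1)) / (M + 1)) <= Gamma a.
Proof.
move=> a0 M0; have M10 : 0 < M + 1 by rewrite addr_gt0.
rewrite -lee_fin EFin_Gamma//.
apply: (@le_trans _ _
  (\int[mu]_(x in `[M, (M + 1)%R]) (gamma_integrand a x)%:E)%E); last first.
  apply: ge0_subset_integral => //.
  - by apply/measurable_EFinP; exact: measurable_gamma_integrand.
  - by move=> x _; rewrite lee_fin gamma_integrand_ge0.
  - by move=> x /=; rewrite !in_itv/= andbT => /andP[+ _]; exact: lt_le_trans.
rewrite -[leLHS]mule1.
have <- : mu `[M, (M + 1)%R] = 1%E.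
  rewrite lebesgue_measure_itv/= lte_fin ltrDl ltr01 -EFinD; congr EFin.
  by rewrite addrAC subrr add0r.
rewrite -integral_cst//; apply: ge0_le_integral => //.
- by move=> x _; rewrite lee_fin mulr_ge0 ?powR_ge0// divr_ge0 ?expR_ge0 ?ltW.
- by apply/measurable_EFinP; exact: measurable_gamma_integrand.
- move=> x /=; rewrite in_itv/= => /andP[Mx xM]; rewrite lee_fin.
  have x0 : 0 < x by rewrite (lt_le_trans M0).
  rewrite [_ / _]mulrC mulrA ler_pM ?expR_ge0//; last by rewrite ler_expR lerN2.
    by rewrite divr_ge0 ?powR_ge0// ltW.
  rewrite ler_pdivrMr// mulrC.
  rewrite (le_trans (_ : _ <= x * x `^ (a - 1)))//.
    rewrite mulr_powRB1 ?(ltW x0)//.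
    by rewrite ge0_ler_powR ?(ltW a0)// nnegrE ltW.
  by rewrite ler_wpM2r ?powR_ge0.
Qed.

Lemma Gamma_gt0 (a : R) : 0 < a -> 0 < Gamma a.
Proof.
move=> a0; rewrite -lte_fin EFin_Gamma//.
apply: (@lt_le_trans _ _
  (\int[mu]_(x in `[1%R, 2%R]) (gamma_integrand a x)%:E)%E); last first.
  apply: ge0_subset_integral => //.
  - by apply/measurable_EFinP; exact: measurable_gamma_integrand.
  - by move=> x _; rewrite lee_fin gamma_integrand_ge0.
  - by move=> x /=; rewrite !in_itv/= andbT => /andP[+ _]; exact: lt_le_trans.
apply: (@lt_le_trans _ _ (\int[mu]_(x in `[1%R, 2%R]) (2^-1 * expR (-2))%:E)%E).
  rewrite integral_cst//= lebesgue_measure_itv/= lte_fin ltr1n/=.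
  rewrite -EFinD -EFinM lte_fin !mulr_gt0 ?expR_gt0// subr_gt0 ltr1n.
apply: ge0_le_integral => //.
- by apply/measurable_EFinP; exact: measurable_gamma_integrand.
- move=> x /=; rewrite in_itv/= => /andP[x1 x2]; rewrite lee_fin.
  have x0 : 0 < x by rewrite (lt_le_trans ltr01).
  rewrite ler_pM ?expR_ge0//; last by rewrite ler_expR lerN2.
  apply: (@le_trans _ _ (x `^ (-1))); last by apply: ler_powR => //; lra.
  by rewrite powR_inv1 ?(ltW x0)// lef_pV2 ?posrE.
Qed.

End gamma.

(** * The Beta integral *)

Section beta.
Context {R : realType}.
Notation mu := (@lebesgue_measure R).

Lemma ge0_integralZl_real (D : set R) (k : R) (f : R -> R) :
  measurable D -> measurable_fun D f -> (forall x, 0 <= f x) -> 0 <= k ->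
  (\int[mu]_(x in D) (k%:E * (f x)%:E) = k%:E * \int[mu]_(x in D) (f x)%:E)%E.
Proof.
move=> mD mf f0 k0; apply: ge0_integralZl => //.
- exact/measurable_EFinP.
- by move=> x _; rewrite lee_fin.
Qed.

Lemma gt0_powRD (x r s : R) : 0 < x -> x `^ (r + s) = x `^ r * x `^ s.
Proof. by move=> x0; rewrite powRD// [x == 0]gt_eqF// implybT. Qed.

Definition conv_powR (a b t s : R) : R := (t - s) `^ (a - 1) * s `^ (b - 1).

Lemma conv_powR_ge0 (a b t s : R) : 0 <= conv_powR a b t s.
Proof. by rewrite mulr_ge0 ?powR_ge0. Qed.

Lemma measurable_conv_powR (a b t : R) (D : set R) :
  measurable_fun D (conv_powR a b t).
Proof.
apply: measurable_funTS; apply: measurable_funM; last exact: measurable_powR.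
apply: (measurableT_comp (measurable_powR _)).
by apply: measurable_funB.
Qed.

(** An extended real, because finiteness is only obtained together with the value, in [ebetaE]. *)
Definition ebeta (a b : R) : \bar R :=
  (\int[mu]_(s in `]0%R, 1%R[) (conv_powR a b 1 s)%:E)%E.

Lemma ebeta_ge0 (a b : R) : (0 <= ebeta a b)%E.
Proof. by apply: integral_ge0 => x _; rewrite lee_fin conv_powR_ge0. Qed.

Lemma integral_conv_powR_ebeta (a b t : R) : 0 < t ->
  (\int[mu]_(s in `]0%R, t%R[) (conv_powR a b t s)%:E =
   (t `^ (a + b - 1))%:E * ebeta a b)%E.
Proof.
move=> t0; rewrite (ge0_integral_affine 0 t0); last 3 first.
- exact: measurable_itv.
- by apply/measurable_EFinP; exact: measurable_conv_powR.
- by move=> x _; rewrite lee_fin conv_powR_ge0.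
have -> : (fun x : R => t * x + 0) @^-1` `]0, t[ = `]0, 1[%classic.
  have tx x : (t * x < t) = (x < 1) by rewrite -{2}[t]mulr1 ltr_pM2l.
  by apply/seteqP; split => x /=; rewrite !in_itv/= addr0 pmulr_rgt0// tx.
transitivity (t%:E * \int[mu]_(x in `]0%R, 1%R[)
    ((t `^ (a + b - 2))%:E * (conv_powR a b 1 x)%:E))%E.
  congr (_ * _)%E; apply: eq_integral => x; rewrite inE/= in_itv/= => /andP[x0 x1].
  rewrite -EFinM /conv_powR addr0 (_ : t - t * x = t * (1 - x)); last by ring.
  rewrite !powRM ?(ltW t0) ?(ltW x0)//; last by rewrite subr_ge0 ltW.
  rewrite (_ : a + b - 2 = (a - 1) + (b - 1)); last by ring.
  rewrite [in RHS]gt0_powRD//.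
  by congr EFin; ring.
rewrite ge0_integralZl_real ?powR_ge0//; last 2 first.
- exact: measurable_conv_powR.
- by move=> x; exact: conv_powR_ge0.
rewrite muleA -EFinM; congr ((_%:E) * _)%E.
rewrite (_ : a + b - 1 = 1 + (a + b - 2)); last by ring.
rewrite [in RHS]gt0_powRD//.
by rewrite powRr1// ltW.
Qed.

(* The two iterated integrals of F are Gamma a * Gamma b and
   ebeta a b * Gamma (a + b). *)
Let F (a b : R) (z : R * R) : \bar R :=
  if (0 < z.1) && (z.1 < z.2) then
    (conv_powR a b z.2 z.1 * expR (- z.2))%:E else 0%E.

Let mF (a b : R) : measurable_fun setT (F a b).
Proof.
apply: measurable_fun_ifT => //.
  apply: measurable_and; apply: measurable_fun_ltr => //.
apply/measurable_EFinP; apply: measurable_funM.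
  apply: measurable_funM.
    apply: (measurableT_comp (measurable_powR _)).
    by apply: measurable_funB.
  exact: (measurableT_comp (measurable_powR _)).
apply: measurableT_comp; first exact: measurable_expR.
apply: measurableT_comp; last exact: measurable_snd.
exact: oppr_measurable.
Qed.

Let F_ge0 (a b : R) z : (0 <= F a b z)%E.
Proof. by rewrite /F; case: ifP => // _; rewrite lee_fin mulr_ge0 ?conv_powR_ge0 ?expR_ge0. Qed.

Let F1 (a b s : R) : 0 < a ->
  (\int[mu]_t F a b (s, t) =
   if (0 < s)%R then (Gamma a)%:E * (gamma_integrand b s)%:E else 0)%E.
Proof.
move=> a0; rewrite /F/=; case: ifPn => s0; last first.
  by rewrite integral0_eq// => x _.
transitivity (\int[mu]_(t in `]s%R, +oo[) (conv_powR a b t s * expR (- t))%:E)%E.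
  rewrite [RHS]integral_mkcond; apply: eq_integral => t _.
  by rewrite patchE/= mem_setE in_itv/= andbT.
(* Shifting t by s turns the factor exp(- t) into exp(- s) exp(- x) and leaves the Gamma integral in
   x. *)
rewrite (ge0_integral_affine s ltr01)//; last 2 first.
- apply/measurable_EFinP; apply: measurable_funTS; apply: measurable_funM.
    apply: measurable_funM => //.
    apply: (measurableT_comp (measurable_powR _)).
    by apply: measurable_funB.
  by apply: measurableT_comp.
- by move=> x _; rewrite lee_fin mulr_ge0 ?conv_powR_ge0 ?expR_ge0.
have -> : (fun x : R => 1 * x + s) @^-1` `]s, +oo[ = `]0, +oo[%classic.
  by apply/seteqP; split => x /=; rewrite !in_itv/= !andbT mul1r ltrDr.
rewrite mul1e EFin_Gamma// muleC -ge0_integralZl_real ?gamma_integrand_ge0//; last 2 first.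
- exact: measurable_gamma_integrand.
- by move=> x; exact: gamma_integrand_ge0.
apply: eq_integral => x _; rewrite -EFinM; congr EFin.
by rewrite /conv_powR /gamma_integrand mul1r addrK opprD expRD; ring.
Qed.

Let F2 (a b t : R) :
  (\int[mu]_s F a b (s, t) =
   if (0 < t)%R then ebeta a b * (gamma_integrand (a + b) t)%:E else 0)%E.
Proof.
rewrite /F/=; case: ifPn => t0; last first.
  rewrite integral0_eq// => x _; case: ifP => // /andP[x0 /(lt_trans x0)].
  by move=> t0'; rewrite t0' in t0.
transitivity (\int[mu]_(s in `]0%R, t%R[)
  ((expR (- t))%:E * (conv_powR a b t s)%:E))%E.
  rewrite [RHS]integral_mkcond; apply: eq_integral => s _.
  by rewrite patchE/= mem_setE in_itv/=; case: ifP; rewrite // -EFinM mulrC.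
rewrite ge0_integralZl_real ?expR_ge0//; last 2 first.
- exact: measurable_conv_powR.
- by move=> x; exact: conv_powR_ge0.
by rewrite integral_conv_powR_ebeta// muleA -EFinM mulrC muleC.
Qed.

Lemma ebetaE (a b : R) : 0 < a -> 0 < b ->
  ebeta a b = (Gamma a * Gamma b / Gamma (a + b))%:E.
Proof.
move=> a0 b0; have ab0 : 0 < a + b by rewrite addr_gt0.
have IL : (\int[mu]_x (if (0 < x)%R then (Gamma a)%:E * (gamma_integrand b x)%:E else 0) =
    (Gamma a)%:E * (Gamma b)%:E)%E.
  rewrite (EFin_Gamma b0) -ge0_integralZl_real ?(ltW (Gamma_gt0 a0))//; last 2 first.
  - exact: measurable_gamma_integrand.
  - by move=> x; exact: gamma_integrand_ge0.
  rewrite [RHS]integral_mkcond.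
  by apply: eq_integral => x _; rewrite patchE mem_setE in_itv/= andbT.
have IR : (\int[mu]_x (if (0 < x)%R then ebeta a b * (gamma_integrand (a + b) x)%:E else 0) =
    ebeta a b * (Gamma (a + b))%:E)%E.
  rewrite (EFin_Gamma ab0) -ge0_integralZl ?ebeta_ge0//; last 2 first.
  - by apply/measurable_EFinP; exact: measurable_gamma_integrand.
  - by move=> x _; rewrite lee_fin gamma_integrand_ge0.
  rewrite [RHS]integral_mkcond.
  by apply: eq_integral => x _; rewrite patchE mem_setE in_itv/= andbT.
have : ((Gamma a)%:E * (Gamma b)%:E = ebeta a b * (Gamma (a + b))%:E)%E.
  rewrite -IL -IR; under [RHS]eq_integral do rewrite -F2.
  under [LHS]eq_integral do rewrite -F1//.
  exact: (@fubini_tonelli _ _ _ _ R mu mu (F a b) (mF a b) (F_ge0 a b)).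
(* The product of the two Gammas is a real number, which excludes an infinite [ebeta a b]. *)
rewrite -EFinM; have := ebeta_ge0 a b; have := Gamma_gt0 ab0.
case: (ebeta a b) => [r||//] G0 _.
  by rewrite -EFinM => -[->]; rewrite mulfK// gt_eqF.
by rewrite gt0_mulye ?lte_fin.
Qed.

Lemma integral_conv_powR (a b t : R) : 0 < a -> 0 < b -> 0 < t ->
  (\int[mu]_(s in `]0%R, t%R[) (conv_powR a b t s)%:E =
   (Gamma a * Gamma b / Gamma (a + b) * t `^ (a + b - 1))%:E)%E.
Proof.
by move=> a0 b0 t0; rewrite integral_conv_powR_ebeta// ebetaE// -EFinM mulrC.
Qed.

End beta.

(** * Mittag-Leffler functions *)

Section entire_series.
Context {R : realType}.

(** Says that the power series with coefficients c has infinite radius of convergence, in a form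
    that passes to the derived series. *)
Definition superexp_decay (c : nat -> R) :=
  forall r : R, 0 < r -> exists C, forall n, `|c n| <= C * r ^+ n.

(** The decay is used at r / 2, so that the spare factor 2^n absorbs the factor n + 1 of the derived
    series. *)
Lemma superexp_decay_diffs (c : nat -> R) :
  superexp_decay c -> superexp_decay (pseries_diffs c).
Proof.
move=> dc r r0; have [|C hC] := dc (r / 2); first by rewrite divr_gt0.
exists (C * (r / 2)) => n; rewrite /pseries_diffs normrM ger0_norm//.
have n2 : n.+1%:R <= 2 ^+ n :> R by rewrite -natrX ler_nat ltn_expl.
rewrite (le_trans (ler_pM _ _ n2 (hC n.+1)))//.
rewrite exprS [(r / 2) ^+ n]expr_div_n.
rewrite le_eqVlt; apply/orP; left; apply/eqP; field.
by rewrite expf_neq0.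
Qed.

Lemma superexp_decay_cvg_norm (c : nat -> R) (x : R) : superexp_decay c ->
  cvgn (series (fun n => `|c n * x ^+ n|)).
Proof.
move=> dc; have x0 : 0 < `|x| + 1 by rewrite ltr_wpDl.
(* At this rate the n-th term is at most C / 2^n; adding 1 to the norm avoids dividing by 0. *)
have [|C hC] := dc (2^-1 / (`|x| + 1)); first by rewrite divr_gt0.
have C0 : 0 <= C by have := hC 0%N; rewrite expr0 mulr1; apply: le_trans.
apply: (@series_le_cvg _ _ (geometric C (2^-1))).
- by move=> n.
- by move=> n; rewrite mulr_ge0 ?exprn_ge0.
- move=> n; rewrite normrM normrX /geometric/=.
  rewrite (le_trans (ler_wpM2r _ (hC n)))// -mulrA ler_wpM2l// -exprMn.
  rewrite lerXn2r ?nnegrE ?mulr_ge0 ?invr_ge0// ?(ltW x0)//.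
  rewrite -mulrA ler_piMr ?invr_ge0// mulrC ler_pdivrMr// mul1r.
  by rewrite lerDl.
- by apply: is_cvg_geometric_series; rewrite ger0_norm// invf_lt1// ltr1n.
Qed.

Lemma superexp_decay_cvg (c : nat -> R) (x : R) : superexp_decay c ->
  cvgn (pseries c x).
Proof. by move=> dc; apply: normed_cvg; exact: superexp_decay_cvg_norm. Qed.

Lemma superexp_decay_continuous (c : nat -> R) : superexp_decay c ->
  continuous (fun x => limn (pseries c x)).
Proof.
move=> dc x; apply: differentiable_continuous; apply/derivable1_diffP.
have dc1 := superexp_decay_diffs dc; have dc2 := superexp_decay_diffs dc1.
have [] // := @pseries_snd_diffs _ c (`|x| + 1) x.
- exact: superexp_decay_cvg.
- exact: superexp_decay_cvg.
- exact: superexp_decay_cvg.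
- by rewrite [ltRHS]ger0_norm ?addr_ge0// ltrDl.
Qed.

End entire_series.

Section mittag_leffler_series.
Context {R : realType}.
Variable rho : R.
Hypothesis rho_gt0 : 0 < rho.
Local Notation E := (mittag_leffler rho).

Definition ml_coef (b : R) (j : nat) : R := (Gamma (rho * j%:R + b))^-1.

Lemma ml_arg_gt0 (b : R) j : 0 < b -> 0 < rho * j%:R + b.
Proof. by move=> b0; rewrite ltr_wpDl// mulr_ge0// ltW. Qed.

Lemma ml_coef_gt0 (b : R) j : 0 < b -> 0 < ml_coef b j.
Proof. by move=> b0; rewrite invr_gt0 Gamma_gt0// ml_arg_gt0. Qed.

Lemma ml_coef_decay (b : R) : 0 < b -> superexp_decay (ml_coef b).
Proof.
(* This M satisfies M^(rho j) = r^(- j), so that [Gamma_lower_bound] yields exactly the rate r^j. *)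
move=> b0 r r0; pose M := r `^ (- rho^-1).
have M0 : 0 < M by rewrite powR_gt0.
pose K := expR (- (M + 1)) / (M + 1).
have K0 : 0 < K by rewrite divr_gt0 ?expR_gt0// addr_gt0.
exists (M `^ (- b) / K) => j.
rewrite ger0_norm ?(ltW (ml_coef_gt0 _ _))//.
have -> : M `^ (- b) / K * r ^+ j = (M `^ (rho * j%:R + b) * K)^-1.
  have -> : M `^ (rho * j%:R + b) = (r ^+ j)^-1 * M `^ b.
    rewrite gt0_powRD//; congr (_ * _); rewrite /M -powRrM mulrA mulNr mulVf ?gt_eqF//.
    by rewrite mulN1r powRN powR_mulrn// ltW.
  by rewrite powRN; field; rewrite !gt_eqF ?powR_gt0 ?exprn_gt0.
rewrite lef_pV2 ?posrE ?Gamma_gt0 ?ml_arg_gt0 ?(mulr_gt0 _ K0) ?powR_gt0//.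
by apply: Gamma_lower_bound => //; exact: ml_arg_gt0.
Qed.

Lemma mittag_lefflerE (b x : R) : E b x = limn (pseries (ml_coef b) x).
Proof.
rewrite /mittag_leffler /pseries; congr (limn (series _)).
by apply/funext => j; rewrite mulrC.
Qed.

Lemma mittag_leffler_cvg (b x : R) : 0 < b ->
  pseries (ml_coef b) x @ \oo --> E b x.
Proof.
by move=> b0; rewrite mittag_lefflerE; apply: superexp_decay_cvg; exact: ml_coef_decay.
Qed.

Lemma mittag_leffler_continuous (b : R) : 0 < b -> continuous (E b).
Proof.
move=> b0; rewrite (_ : E b = fun x => limn (pseries (ml_coef b) x)).
  exact/superexp_decay_continuous/ml_coef_decay.
by apply/funext => x; rewrite mittag_lefflerE.
Qed.

Lemma mittag_leffler0 (b : R) : 0 < b -> E b 0 = (Gamma b)^-1.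
Proof.
move=> b0; rewrite mittag_lefflerE; apply/cvg_lim => //.
rewrite -cvg_shiftS /=; apply: cvg_near_cst; apply: nearW => n /=.
rewrite /pseries /series/= big_nat_recl// big1 => [|i _].
  by rewrite expr0 mulr1 addr0 /ml_coef mulr0 add0r.
by rewrite expr0n mulr0.
Qed.

(** Splitting off the term j = 0 raises the second index by rho in all the others. In the form
    [mlk_rec] this becomes the Volterra equation, once the kernel of index b + rho is known to be a
    convolution. *)
Lemma mittag_leffler_rec (b x : R) : 0 < b ->
  E b x = (Gamma b)^-1 + x * E (b + rho) x.
Proof.
move=> b0; have br0 : 0 < b + rho by rewrite addr_gt0.
rewrite [LHS]mittag_lefflerE; apply/cvg_lim => //.
rewrite -cvg_shiftS /=.
rewrite (_ : (fun n => _) =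
  (fun n => (Gamma b)^-1 + x * pseries (ml_coef (b + rho)) x n)).
  by apply: cvgD; [exact: cvg_cst|apply: cvgMr; exact: mittag_leffler_cvg].
apply/funext => n; rewrite /pseries /series/= big_nat_recl// mulr_sumr.
congr (_ + _); first by rewrite expr0 mulr1 /ml_coef mulr0 add0r.
by apply: eq_bigr => i _; rewrite exprS mulrCA /ml_coef -natr1 mulrDr mulr1 -addrA (addrC rho b).
Qed.

Lemma pseries_norm_le (b x y : R) n : 0 < b -> `|x| <= y ->
  \sum_(0 <= i < n) ml_coef b i * `|x| ^+ i <= E b y.
Proof.
move=> b0 xy; have y0 : 0 <= y by apply: le_trans xy.
apply: (@le_trans _ _ (pseries (ml_coef b) y n)).
  rewrite /pseries /series/=; apply: ler_sum => i _.
  rewrite ler_wpM2l ?(ltW (ml_coef_gt0 _ _))//.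
  by rewrite lerXn2r ?nnegrE.
rewrite mittag_lefflerE; apply: nondecreasing_cvgn_le.
  apply/nondecreasing_seqP => m; rewrite /pseries seriesEnat/= big_nat_recr//=.
  by rewrite lerDl mulr_ge0 ?exprn_ge0// ltW// ml_coef_gt0.
by apply: superexp_decay_cvg; exact: ml_coef_decay.
Qed.

End mittag_leffler_series.

Section ml_kernel.
Context {R : realType}.
Notation mu := (@lebesgue_measure R).
Variable rho : R.
Hypothesis rho_gt0 : 0 < rho.

(* The solution kernels: t^(b-1) E_{rho,b}(- lam t^rho). *)
Definition mlk (b lam t : R) : R :=
  t `^ (b - 1) * mittag_leffler rho b (- lam * t `^ rho).

Lemma mlk_continuous (b lam t : R) : 0 < b -> 0 < t ->
  {for t, continuous (mlk b lam)}.
Proof.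
move=> b0 t0; rewrite /mlk; apply: (@continuousM R _ (fun t => t `^ (b - 1))).
  exact: continuous_powR.
apply: continuous_comp; last exact: mittag_leffler_continuous.
apply: (@continuousM R _ (cst (- lam))); first exact: cst_continuous.
exact: continuous_powR.
Qed.

Lemma measurable_mlk (b lam : R) (D : set R) : 0 < b -> measurable_fun D (mlk b lam).
Proof.
move=> b0; apply: measurable_funTS; apply: measurable_funM.
  exact: measurable_powR.
apply: measurableT_comp.
  by apply: continuous_measurable_fun; exact: mittag_leffler_continuous.
by apply: measurable_funM => //; exact: measurable_powR.
Qed.

Lemma mlk_rec (b lam t : R) : 0 < b -> 0 < t ->
  mlk b lam t = t `^ (b - 1) / Gamma b - lam * mlk (b + rho) lam t.
Proof.
move=> b0 t0; rewrite /mlk (mittag_leffler_rec rho_gt0 _ b0).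
rewrite (_ : b + rho - 1 = rho + (b - 1)); last by ring.
by rewrite (gt0_powRD rho (b - 1) t0); ring.
Qed.

Definition mlk_term (b lam t : R) (j : nat) : R :=
  (- lam) ^+ j * ml_coef rho b j * t `^ (rho * j%:R + b - 1).

Lemma mlk_termE (b lam t : R) j : 0 < t ->
  mlk_term b lam t j =
  t `^ (b - 1) * (ml_coef rho b j * (- lam * t `^ rho) ^+ j).
Proof.
move=> t0; rewrite /mlk_term -addrA (gt0_powRD (rho * _) (b - 1) t0) powRrM powR_mulrn ?powR_ge0//.
by rewrite [in RHS]exprMn; ring.
Qed.

Lemma mlk_cvg (b lam t : R) : 0 < b -> 0 < t ->
  series (mlk_term b lam t) @ \oo --> mlk b lam t.
Proof.
move=> b0 t0; rewrite (_ : series _ =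
  (fun n => t `^ (b - 1) * pseries (ml_coef rho b) (- lam * t `^ rho) n)).
  by apply: cvgMr; exact: mittag_leffler_cvg.
apply/funext => n; rewrite /pseries/series/= mulr_sumr.
by apply: eq_bigr => j _; rewrite mlk_termE.
Qed.

(** The Mittag-Leffler factor is taken at t and not at s, so the majorant depends on s only through
    the integrable power s^(b-1). *)
Lemma norm_mlk_sum_le (b lam t s : R) n : 0 < b -> 0 < s <= t ->
  `|series (mlk_term b lam s) n| <=
  s `^ (b - 1) * mittag_leffler rho b (`|lam| * t `^ rho).
Proof.
move=> b0 /andP[s0 st].
rewrite (le_trans (ler_norm_sum _ _ _))//.
under eq_bigr do rewrite mlk_termE// normrM ger0_norm ?powR_ge0// normrM
  ger0_norm ?(ltW (ml_coef_gt0 rho_gt0 _ _))// normrX.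
rewrite -mulr_sumr ler_wpM2l ?powR_ge0//.
apply: pseries_norm_le => //; rewrite normrM normrN ler_wpM2l//.
rewrite ger0_norm ?powR_ge0// ge0_ler_powR ?nnegrE// ?ltW//.
exact: lt_le_trans st.
Qed.

(** Termwise, the Beta integral replaces t^(rho j + b - 1) / Gamma(rho j + b) by the same expression
    with a + b: fractional integration shifts the second index. The case a = rho is the Volterra
    term, a = 1 the primitive, a = 1 - rho the fractional integral of the initial condition. *)
Lemma conv_powR_mlk (a b lam t : R) : 0 < a -> 0 < b -> 0 < t ->
  mu.-integrable `]0, t[ (fun s => ((t - s) `^ (a - 1) * mlk b lam s)%:E) /\
  (\int[mu]_(s in `]0%R, t[) ((t - s) `^ (a - 1) * mlk b lam s)%:E =
    (Gamma a * mlk (a + b) lam t)%:E)%E.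
Proof.
move=> a0 b0 t0.
have ab0 : 0 < a + b by rewrite addr_gt0.
pose D : R := mittag_leffler rho b (`|lam| * t `^ rho).
have mp : measurable_fun `]0, t[ (fun s => (t - s) `^ (a - 1)).
  apply: measurable_funTS; apply: (measurableT_comp (measurable_powR _)).
  exact: measurable_funB.
pose f_ n s := ((t - s) `^ (a - 1) * series (mlk_term b lam s) n)%:E.
have ic c : 0 < c -> mu.-integrable `]0, t[ (EFin \o conv_powR a c t).
  move=> c0; apply/integrableP; split.
    by apply/measurable_EFinP; exact: measurable_conv_powR.
  under eq_integral do rewrite /= ger0_norm ?conv_powR_ge0//.
  by rewrite integral_conv_powR// ltry.
have intf n : (\int[mu]_(s in `]0%R, t[) f_ n s =
    (Gamma a * series (mlk_term (a + b) lam t) n)%:E)%E.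
  transitivity (\int[mu]_(s in `]0%R, t[) \sum_(0 <= j < n)
    (((- lam) ^+ j * ml_coef rho b j)%:E * (conv_powR a (rho * j%:R + b) t s)%:E))%E.
    apply: eq_integral => s; rewrite inE/= in_itv/= => /andP[s0 _].
    rewrite /f_ /series/= mulr_sumr -sumEFin; apply: eq_bigr => j _.
    by rewrite -EFinM /mlk_term /conv_powR; congr EFin; ring.
  rewrite integral_sum//; last first.
    by move=> j; apply: integrableZl => //; apply: ic; exact: ml_arg_gt0.
  rewrite /series/= mulr_sumr -sumEFin; apply: eq_bigr => j _.
  have cj := ml_arg_gt0 rho_gt0 j b0.
  rewrite integralZl//; last exact: ic.
  rewrite integral_conv_powR// -EFinM; congr EFin.
  rewrite /mlk_term /ml_coef (_ : rho * j%:R + (a + b) = a + (rho * j%:R + b)); last by ring.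
  have := Gamma_gt0 (addr_gt0 a0 cj); have := Gamma_gt0 cj.
  move: (Gamma (a + _)) (Gamma (rho * _ + b)) (Gamma a) => G1 G2 G3 G2_gt0 G1_gt0.
  by field; rewrite !gt_eqF.
(* The powers of - lam can alternate in sign, so the partial sums need not be monotone; D sums their
   absolute values. *)
have [] := @dominated_convergence _ _ R mu `]0, t[ (measurable_itv _) f_
  (fun s => ((t - s) `^ (a - 1) * mlk b lam s)%:E)
  (fun s => D%:E * (conv_powR a b t s)%:E)%E.
- move=> n; apply/measurable_EFinP; apply: measurable_funM => //.
  apply: measurable_sum => j; apply: measurable_funTS.
  by apply: measurable_funM => //; exact: measurable_powR.
- by apply/measurable_EFinP; apply: measurable_funM => //; exact: measurable_mlk.
- apply: aeW => s /=; rewrite in_itv/= => /andP[s0 _].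
  by apply: cvg_EFin; [exact: nearW|apply: cvgMr; exact: mlk_cvg].
- by apply: integrableZl => //; exact: ic.
- apply: aeW => s n /=; rewrite in_itv/= => /andP[s0 st].
  rewrite lee_fin normrM ger0_norm ?powR_ge0// /conv_powR mulrCA ler_wpM2l ?powR_ge0//.
  by rewrite mulrC; apply: norm_mlk_sum_le; rewrite ?s0 ?ltW.
move=> int_ _ cv; split => //.
rewrite -(cvg_lim _ cv)//; apply/cvg_lim => //.
rewrite (_ : [sequence _]_n = EFin \o
  (fun n => Gamma a * series (mlk_term (a + b) lam t) n)); last first.
  by apply/funext => n; rewrite /= intf.
by apply: cvg_EFin; [exact: nearW|apply: cvgMr; exact: mlk_cvg].
Qed.

End ml_kernel.

(** * Positivity and bounds of the kernels *)

Section mlk_positivity.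
Context {R : realType}.
Notation mu := (@lebesgue_measure R).
Variable rho : R.
Hypotheses (rho_gt0 : 0 < rho) (rho_lt1 : rho < 1).

Lemma powR_neg_le (x y : R) : 0 < x -> x <= y -> y `^ (rho - 1) <= x `^ (rho - 1).
Proof.
move=> x0 xy; have y0 : 0 < y by apply: lt_le_trans xy.
have r0 : 0 <= 1 - rho by rewrite subr_ge0 ltW.
rewrite -opprB !powRN lef_pV2 ?posrE ?powR_gt0//.
by rewrite ge0_ler_powR// nnegrE ltW.
Qed.

(** This is where log-convexity enters. As the exponent rho - 1 is negative, the claim reduces to u
    (t - s) <= t (u - s), that is, s t <= s u. *)
Lemma powR_neg_ratio_le (s t u : R) : 0 <= s -> s < t -> t <= u ->
  (u - s) `^ (rho - 1) <= u `^ (rho - 1) / t `^ (rho - 1) * (t - s) `^ (rho - 1).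
Proof.
move=> s0 st tu; have t0 : 0 < t by apply: le_lt_trans st.
have u0 : 0 < u by apply: lt_le_trans tu.
have ts : 0 < t - s by rewrite subr_gt0.
have us : 0 < u - s by rewrite subr_gt0 (lt_le_trans st).
rewrite mulrAC ler_pdivlMr ?powR_gt0//.
rewrite -!powRM ?(ltW u0) ?(ltW ts) ?(ltW us) ?(ltW t0)//.
apply: powR_neg_le; first by rewrite mulr_gt0.
by rewrite mulrBr mulrBl lerB// 1?[u * t]mulrC// mulrC ler_wpM2r.
Qed.

(** The last term is m times the integral of (u - s)^(rho - 1) over ]t, u[, which is (u - t)^rho /
    rho; the quotient of Gammas is the Beta integral with b = 1. *)
Lemma conv_powR_split_le (e : R -> R) (t u m : R) : 0 < t -> t < u ->
  measurable_fun setT e -> (forall s, 0 < s < u -> 0 <= e s) ->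
  (forall s, t < s < u -> e s <= m) -> 0 <= m ->
  (\int[mu]_(s in `]0%R, u[) ((u - s) `^ (rho - 1) * e s)%:E <=
   (u `^ (rho - 1) / t `^ (rho - 1))%:E *
     \int[mu]_(s in `]0%R, t[) ((t - s) `^ (rho - 1) * e s)%:E +
   (m * (Gamma rho / Gamma (rho + 1) * (u - t) `^ rho))%:E)%E.
Proof.
move=> t0 tu me e0 em m0; have u0 : 0 < u by apply: lt_trans tu.
have mf (v : R) (D : set R) : measurable_fun D (fun s : R => (v - s) `^ (rho - 1)).
  apply: measurable_funTS; apply: (measurableT_comp (measurable_powR _)).
  exact: measurable_funB.
have mfe (v : R) (D : set R) : measurable_fun D (fun s : R => ((v - s) `^ (rho - 1) * e s)%:E).
  by apply/measurable_EFinP; apply: measurable_funM => //; exact: measurable_funTS.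
rewrite (@itv_bndbnd_setU _ _ _ (BRight t)) ?bnd_simp//; last exact: ltW.
rewrite ge0_integral_setU//=; last 3 first.
- exact: mfe.
- move=> s /=; rewrite !in_itv/= => -[|] /andP[s1 s2];
    rewrite lee_fin mulr_ge0 ?powR_ge0 ?e0//.
    by rewrite s1 (le_lt_trans s2).
  by rewrite s2 (lt_trans t0).
- apply/disj_set2P; rewrite -subset0 => x [] /=.
  by rewrite !in_itv/= => /andP[_ +] /andP[+ _] => /le_lt_trans /[apply]; rewrite ltxx.
rewrite -[X in (X + _ <= _)%E]integral_itv_bndo_bndc; last exact: mfe.
apply: leeD.
- rewrite -ge0_integralZl//=; last 3 first.
  + exact: mfe.
  + move=> s; rewrite in_itv/= => /andP[s0 st].
    by rewrite lee_fin mulr_ge0 ?powR_ge0 ?e0// s0 (lt_trans st).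
  + by rewrite lee_fin divr_ge0 ?powR_ge0.
  apply: ge0_le_integral => //.
  + move=> s /=; rewrite in_itv/= => /andP[s0 st].
    by rewrite lee_fin mulr_ge0 ?powR_ge0 ?e0// s0 (lt_trans st).
  + exact: mfe.
  + by apply: measurable_funeM; exact: mfe.
  + move=> s /=; rewrite in_itv/= => /andP[s0 st].
    rewrite -EFinM lee_fin mulrA ler_wpM2r ?e0 ?s0 ?(lt_trans st)//.
    by apply: powR_neg_ratio_le => //; rewrite ltW.
- apply: (@le_trans _ _
    (\int[mu]_(s in `]t, u[) (m%:E * ((u - s) `^ (rho - 1))%:E))%E).
    apply: ge0_le_integral => //.
    + move=> s /=; rewrite in_itv/= => /andP[ts su].
      by rewrite lee_fin mulr_ge0 ?powR_ge0 ?e0// su (lt_trans t0).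
    + exact: mfe.
    + by apply: measurable_funeM; apply/measurable_EFinP; exact: mf.
    + move=> s /=; rewrite in_itv/= => tsu.
      by rewrite -EFinM lee_fin mulrC ler_wpM2r ?powR_ge0 ?em.
  rewrite ge0_integralZl_real//; last first.
    by move=> s; exact: powR_ge0.
  rewrite (ge0_integral_affine t ltr01)//; last 2 first.
  + by apply/measurable_EFinP; exact: mf.
  + by move=> s _; rewrite lee_fin powR_ge0.
  rewrite mul1e.
  have -> : (fun x : R => 1 * x + t) @^-1` `]t, u[ = `]0, u - t[%classic.
    by apply/seteqP; split => x /=; rewrite !in_itv/= mul1r ltrDr ltrBrDr.
  have ut0 : 0 < u - t by rewrite subr_gt0.
  rewrite (_ : (\int[mu]_(x in _) _)%E =
    (\int[mu]_(s in `]0%R, (u - t)%R[) (conv_powR rho 1 (u - t) s)%:E)%E); last first.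
    apply: eq_integral => s _; rewrite /conv_powR subrr powRr0 mulr1.
    by congr (_ `^ _)%:E; ring.
  rewrite integral_conv_powR// Gamma1 mulr1 -EFinM lee_fin.
  by rewrite addrK.
Qed.

Lemma mlk_volterra (lam : R) : exists I : R -> R, forall t, 0 < t ->
  (\int[mu]_(s in `]0%R, t[) ((t - s) `^ (rho - 1) * mlk rho rho lam s)%:E =
    (I t)%:E)%E /\
  t `^ (rho - 1) = Gamma rho * mlk rho rho lam t + lam * I t.
Proof.
exists (fun t => Gamma rho * mlk rho (rho + rho) lam t) => t t0; split.
  exact: (conv_powR_mlk rho_gt0 lam rho_gt0 rho_gt0 t0).2.
rewrite [in RHS]mlk_rec//.
by field; rewrite gt_eqF// Gamma_gt0.
Qed.

(* Suppose that e u <= 0, and let t maximize e on [u - d, u] with d small.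
   Splitting the Volterra integral at u over ]0, t[ and ]t, u[, log-convexity
   bounds the first part by the Volterra integral at t, and the second one is at
   most e t times a quantity that is small with d; together they leave no room
   for e t > 0. *)
Lemma mlk_gt0_extend (lam u : R) : 0 < lam -> 0 < u ->
  (forall s, 0 < s < u -> 0 < mlk rho rho lam s) -> 0 < mlk rho rho lam u.
Proof.
move=> lam0 u0 pos; rewrite ltNge; apply/negP => eu.
have me := measurable_mlk rho_gt0 lam rho_gt0.
have conv_split t v m (t0 : 0 < t) (tv : t < v) := conv_powR_split_le (m := m) t0 tv (me setT).
have e_cont x (x0 : 0 < x) := mlk_continuous rho_gt0 (lam := lam) rho_gt0 x0.
have [I VI] := mlk_volterra lam.
have G0 := Gamma_gt0 rho_gt0.
have C0 := divr_gt0 G0 (Gamma_gt0 (addr_gt0 rho_gt0 ltr01)).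
move: pos eu conv_split e_cont VI G0 C0 {me}.
move: (Gamma rho / Gamma (rho + 1)) => C; move: (Gamma rho) => G.
move: (mlk rho rho lam) => e pos eu conv_split e_cont VI G0 C0.
have [d [d0 du dC]] : exists d, [/\ 0 < d, d <= u / 2 & lam * C * d `^ rho < G / 2].
  (* As lam C q = G / 4, the bound d <= q^(1/rho) makes lam C d^rho smaller than G / 2. The bound d
     <= u / 2 keeps [u - d, u] away from 0. *)
  pose q := G / (lam * C * 4).
  have q0 : 0 < q by rewrite divr_gt0// mulr_gt0// mulr_gt0.
  exists (Num.min (u / 2) (q `^ rho^-1)); split.
  - by rewrite lt_min powR_gt0// divr_gt0.
  - by rewrite ge_min lexx.
  - apply: (@le_lt_trans _ _ (lam * C * q)).
      rewrite ler_pM2l; last by rewrite mulr_gt0.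
      apply: (@le_trans _ _ ((q `^ rho^-1) `^ rho)).
        rewrite ge0_ler_powR ?(ltW rho_gt0)// ?nnegrE ?powR_ge0//.
          by rewrite le_min powR_ge0 divr_ge0// ltW.
        by rewrite ge_min lexx orbT.
      by rewrite -powRrM mulVf ?gt_eqF// powRr1// ltW.
    rewrite /q; rewrite (_ : lam * C * _ = G / 4); last first.
      by field; rewrite !gt_eqF.
    by rewrite ltr_pM2l// ltf_pV2 ?posrE// ltr_nat.
have ud0 : 0 < u - d by rewrite subr_gt0; lra.
have udu : u - d < u by lra.
have cont : {within `[u - d, u], continuous e}.
  apply: continuous_in_subspaceT => x; rewrite inE/= in_itv/= => /andP[x1 _].
  by apply: e_cont; exact: lt_le_trans x1.
have [t t_in tmax] := EVT_max (ltW udu) cont.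
move: t_in; rewrite in_itv/= => /andP[t1 t2].
have et0 : 0 < e t.
  apply: lt_le_trans (tmax (u - d) _); first by apply: pos; rewrite ud0.
  by rewrite in_itv/= lexx ltW.
have tu : t < u.
  by rewrite lt_neqAle t2 andbT; apply: contraTneq et0 => ->; rewrite -leNgt.
have t0 : 0 < t by apply: lt_le_trans t1.
have := conv_split t u (e t) t0 tu.
have /[swap]/[apply] : forall s, 0 < s < u -> 0 <= e s by move=> s /pos/ltW.
have /[swap]/[apply] : forall s, t < s < u -> e s <= e t.
  move=> s /andP[ts su]; apply: tmax; rewrite in_itv/= (ltW su) andbT.
  by rewrite (le_trans t1)// ltW.
move/(_ (ltW et0)).
have [-> Vu] := VI _ u0; have [-> Vt] := VI _ t0.
rewrite -EFinM -EFinD lee_fin.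
have kt0 : 0 < t `^ (rho - 1) by rewrite powR_gt0.
have ku0 : 0 < u `^ (rho - 1) by rewrite powR_gt0.
(* Since t >= u - d >= u / 2, the ratio is at least 2^(rho - 1), hence at least 1 / 2. *)
have ratio : 2^-1 <= u `^ (rho - 1) / t `^ (rho - 1).
  rewrite ler_pdivlMr// -[rho - 1]opprB !powRN.
  have r0 : 0 < 1 - rho by rewrite subr_gt0.
  rewrite -invfM lef_pV2 ?posrE ?mulr_gt0 ?powR_gt0//.
  apply: (@le_trans _ _ ((2 * t) `^ (1 - rho))).
    by rewrite ge0_ler_powR ?nnegrE ?(ltW r0) ?(ltW u0) ?mulr_ge0 ?(ltW t0)//; lra.
  rewrite powRM ?(ltW t0)// ler_wpM2r ?powR_ge0//.
  by rewrite -[leRHS]powRr1//; apply: ler_powR; rewrite ?ler1n// gerBl ltW.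
have udC : lam * (C * (u - t) `^ rho) < G / 2.
  apply: le_lt_trans dC; rewrite mulrA ler_wpM2l//.
    by rewrite mulr_ge0// ltW.
  by rewrite ge0_ler_powR ?(ltW rho_gt0)// ?nnegrE ?subr_ge0//; lra.
set r := u `^ (rho - 1) / t `^ (rho - 1) in ratio *.
have ku : u `^ (rho - 1) = r * t `^ (rho - 1) by rewrite /r mulfVK// gt_eqF.
rewrite ku Vt in Vu.
move: (C * _) udC (I t) (I u) Vu => X udC It Iu Vu le.
(* Comparing the Volterra equation at u with r times the one at t gives e t (r G - lam X) <= G (e
   u), where the left side is positive ([h2]) and the right side is not ([h3]). *)
have h1 : lam * Iu <= lam * (r * It + e t * X) by rewrite ler_wpM2l ?(ltW lam0).
have h2 : 0 < e t * (r * G - lam * X).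
  rewrite mulr_gt0// subr_gt0 (lt_le_trans udC)// mulrC.
  by rewrite ler_wpM2r ?(ltW G0).
have h3 : G * e u <= 0 by rewrite pmulr_rle0.
lra.
Qed.

End mlk_positivity.

Section mlk_bounds.
Context {R : realType}.
Notation mu := (@lebesgue_measure R).
Variable rho : R.
Hypotheses (rho_gt0 : 0 < rho) (rho_lt1 : rho < 1).

Lemma mlk_near0_gt0 (lam : R) : \forall t \near (0:R)^'+, 0 < mlk rho rho lam t.
Proof.
have cvE : mittag_leffler rho rho (- lam * t `^ rho) @[t --> (0:R)^'+] --> (Gamma rho)^-1.
  rewrite -(mittag_leffler0 rho rho_gt0).
  have h : - lam * t `^ rho @[t --> (0:R)^'+] --> - lam * 0.
    by apply: cvgMr; exact: powR_cvg0.
  rewrite mulr0 in h; apply: (@cvg_comp _ _ _ _ (mittag_leffler rho rho) _ _ _ h).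
  exact: mittag_leffler_continuous.
have G0 : 0 < (Gamma rho)^-1 by rewrite invr_gt0 Gamma_gt0.
near=> t; rewrite /mlk mulr_gt0 ?powR_gt0//.
near: t; exact: (cvgr_gt _ cvE).
Unshelve. all: by end_near. Qed.

(** Otherwise the set of points where the kernel is nonpositive has an infimum, which is positive by
    the behaviour at 0. The kernel is positive before it, hence at it by [mlk_gt0_extend], hence
    shortly after it by continuity, against the definition of the infimum. *)
Lemma mlk_gt0 (lam t : R) : 0 < lam -> 0 < t -> 0 < mlk rho rho lam t.
Proof.
move=> lam0 t0; rewrite ltNge; apply/negP => et.
pose S := [set s : R | 0 < s /\ mlk rho rho lam s <= 0].
have St : S t by [].
have S_lb : has_lbound S by exists 0 => s [/ltW].
have S_inf : has_inf S by split => //; exists t.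
have u_lb s : S s -> inf S <= s by move=> Ss; exact: ge_inf.
have u0 : 0 < inf S.
  have [d /= d0 dP] := mlk_near0_gt0 lam.
  apply: (@lt_le_trans _ _ d) => //.
  apply: lb_le_inf; first by exists t.
  move=> s [s0]; apply: contra_leT; rewrite -!ltNge => sd.
  by apply: dP => //=; rewrite sub0r normrN gtr0_norm.
have pos s : 0 < s < inf S -> 0 < mlk rho rho lam s.
  move=> /andP[s0 su]; rewrite ltNge; apply/negP => es.
  by have := u_lb s (conj s0 es); rewrite leNgt su.
have eu := mlk_gt0_extend rho_gt0 rho_lt1 lam0 u0 pos.
have [d /= d0 dP] := cvgr_gt _ (@mlk_continuous _ _ rho_gt0 _ lam _ rho_gt0 u0) _ eu.
have [s [s0 es]] := inf_adherent d0 S_inf.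
have su := u_lb s (conj s0 es) => sd.
suff : 0 < mlk rho rho lam s by rewrite ltNge es.
apply: dP => /=; rewrite distrC ger0_norm ?subr_ge0//.
by rewrite ltrBlDl.
Qed.

(** Replacing lam c_(j+1) by k_j - c_j leaves the differences (- m)^(j+1) c_(j+1) - (- m)^j c_j,
    which telescope. *)
Lemma resolvent_telescope (m lam : R) (k c : nat -> R) n :
  (forall j, c j = k j - lam * c j.+1) ->
  (lam - m) * series (fun j => (- m) ^+ j * c j.+1) n =
  series (fun j => (- m) ^+ j * k j) n - c 0%N + (- m) ^+ n * c n.
Proof.
move=> ck; elim: n => [|n ih].
  by rewrite /series/= !big_geq// mulr0 expr0; ring.
rewrite !seriesSr mulrDr ih (ck n) exprS; ring.
Qed.

(* The resolvent identity e_m - e_lam = (lam - m) (e_m * e_lam), where * is the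
   convolution, is obtained by integrating the power series of e_m termwise. *)
Lemma mlk_le_lam (m lam t : R) : 0 < m -> m < lam -> 0 < t ->
  mlk rho rho lam t <= mlk rho rho m t.
Proof.
move=> m0 mlam t0; have lam0 : 0 < lam by apply: lt_trans mlam.
pose b j : R := rho * j%:R + rho.
have b0 j : 0 < b j by exact: ml_arg_gt0.
have bS j : b j + rho = b j.+1 by rewrite /b -natr1; ring.
(* Convolving the j-th term of the series of e_m with e_lam gives (- m)^j c_(j+1), by the index
   shift of [conv_powR_mlk]. *)
pose c j := mlk rho (b j) lam t.
have telescope n : (lam - m) * series (fun j => (- m) ^+ j * c j.+1) n =
    series (mlk_term rho rho m t) n - c 0%N + (- m) ^+ n * c n.
  rewrite (@resolvent_telescope _ _ (fun j => ml_coef rho rho j * t `^ (b j - 1))).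
    congr (_ - _ + _); apply: eq_bigr => j _.
    by rewrite mulrA.
  move=> j; rewrite [_ * t `^ _]mulrC /c -bS.
  exact: mlk_rec.
pose D : R := mittag_leffler rho rho (`|m| * t `^ rho).
pose f_ n s := (series (mlk_term rho rho m (t - s)) n * mlk rho rho lam s)%:E.
have ip j := (conv_powR_mlk rho_gt0 lam (b0 j) rho_gt0 t0).1.
have intf n : (\int[mu]_(s in `]0%R, t[) f_ n s =
    (series (fun j => (- m) ^+ j * c j.+1) n)%:E)%E.
  transitivity (\int[mu]_(s in `]0%R, t[) \sum_(0 <= j < n)
    (((- m) ^+ j * ml_coef rho rho j)%:E *
     ((t - s) `^ (b j - 1) * mlk rho rho lam s)%:E))%E.
    apply: eq_integral => s _.
    rewrite /f_ /series/= mulr_suml -sumEFin; apply: eq_bigr => j _.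
    by rewrite -EFinM /mlk_term; congr EFin; rewrite -/(b j); ring.
  rewrite integral_sum//; last by move=> j; apply: integrableZl.
  rewrite /series/= -sumEFin; apply: eq_bigr => j _.
  rewrite integralZl// (conv_powR_mlk rho_gt0 lam (b0 j) rho_gt0 t0).2 -EFinM.
  rewrite /c -bS /ml_coef -/(b j); congr EFin.
  by field; rewrite gt_eqF ?Gamma_gt0.
have [] := @dominated_convergence _ _ R mu `]0, t[ (measurable_itv _) f_
  (fun s => (mlk rho rho m (t - s) * mlk rho rho lam s)%:E)
  (fun s => D%:E * ((t - s) `^ (rho - 1) * mlk rho rho lam s)%:E)%E.
- move=> n; apply/measurable_EFinP; apply: measurable_funM => //.
    apply: measurable_sum => j; apply: measurable_funTS.
    apply: measurable_funM => //.
    apply: (measurableT_comp (measurable_powR _)).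
    exact: measurable_funB.
  exact: measurable_mlk.
- apply/measurable_EFinP; apply: measurable_funM => //; last exact: measurable_mlk.
  apply: measurable_funTS; apply: measurableT_comp; first exact: measurable_mlk.
  exact: measurable_funB.
- apply: aeW => s /=; rewrite in_itv/= => /andP[s0 st].
  apply: cvg_EFin; [exact: nearW|apply: cvgMl; apply: mlk_cvg => //].
  by rewrite subr_gt0.
- apply: integrableZl => //.
  exact: (conv_powR_mlk rho_gt0 lam rho_gt0 rho_gt0 t0).1.
- apply: aeW => s n /=; rewrite in_itv/= => /andP[s0 st].
  rewrite lee_fin normrM (ger0_norm (ltW (mlk_gt0 lam0 s0))) [leRHS]mulrA.
  rewrite ler_wpM2r ?(ltW (mlk_gt0 lam0 s0))// [leRHS]mulrC.
  by apply: norm_mlk_sum_le; rewrite // subr_gt0 st gerBl ltW.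
move=> intL _ cv.
pose L := (\int[mu]_(s in `]0%R, t[) (mlk rho rho m (t - s) * mlk rho rho lam s)%:E)%E.
have L0 : (0 <= L)%E.
  apply: integral_ge0 => s /=; rewrite in_itv/= => /andP[s0 st].
  by rewrite lee_fin mulr_ge0// ltW// mlk_gt0// subr_gt0.
rewrite (_ : [sequence _]_n =
  (fun n => (series (fun j => (- m) ^+ j * c j.+1) n)%:E)) in cv; last first.
  by apply/funext => n; rewrite /= intf.
have {}cv : series (fun j => (- m) ^+ j * c j.+1) @ \oo --> fine L.
  have Lfin : L \is a fin_num.
    by apply: integrable_fin_num => //.
  by move: cv; rewrite -/L -(fineK Lfin) => /fine_cvgP[_].
have c0E : c 0%N = mlk rho rho lam t by rewrite /c /b mulr0 add0r.
clear intf; clearbody c.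
have L0' : 0 <= fine L by rewrite fine_ge0.
(* Up to the factor - m, the remainder of the telescoping sum is the general term of the convergent
   series [cv]. *)
have c0 : (fun n => (- m) ^+ n.+1 * c n.+1) @ \oo --> 0.
  rewrite -(mulr0 (- m)) (_ : (fun n => _) =
    (fun n => - m * ((- m) ^+ n * c n.+1))); last first.
    by apply/funext => n; rewrite exprS mulrA.
  by apply: cvgMr; apply: cvg_series_cvg_0; apply: cvgP cv.
suff : (lam - m) * fine L = mlk rho rho m t - c 0%N.
  by rewrite c0E => e; rewrite -subr_ge0 -e; apply: mulr_ge0 => //; rewrite subr_ge0 ltW.
have cv1 : (fun n => (lam - m) * series (fun j => (- m) ^+ j * c j.+1) n.+1) @ \oo -->
    (lam - m) * fine L.
  by apply: cvgMr; rewrite cvg_shiftS.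
have cv2 : (fun n => (lam - m) * series (fun j => (- m) ^+ j * c j.+1) n.+1) @ \oo -->
    mlk rho rho m t - c 0%N + 0.
  under eq_fun do rewrite telescope.
  apply: cvgD => //; apply: cvgB; last exact: cvg_cst.
  by rewrite cvg_shiftS; exact: mlk_cvg.
by rewrite addr0 in cv2; rewrite -(cvg_lim _ cv1)// -(cvg_lim _ cv2).
Qed.

End mlk_bounds.

(** * Bounds that are uniform in the eigenvalue *)

Section mlk_estimates.
Context {R : realType}.
Notation mu := (@lebesgue_measure R).
Variables (rho lam : R).
Hypotheses (rho_gt0 : 0 < rho) (rho_lt1 : rho < 1) (lam_gt0 : 0 < lam).
Local Notation e := (mlk rho rho lam).
Local Notation E := (mlk rho 1 lam).

(** Up to Gamma a, this kernel is the convolution of a power with the positive kernel e. It gives a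
    sign to the correction term of [mlk_rec], hence the upper bounds on e and E. *)
Lemma mlk_shift_ge0 (a t : R) : 0 < a -> 0 < t -> 0 <= mlk rho (a + rho) lam t.
Proof.
move=> a0 t0; have G0 := Gamma_gt0 a0.
have [_ H] := conv_powR_mlk rho_gt0 lam a0 rho_gt0 t0.
rewrite -(pmulr_rge0 _ G0) -lee_fin -H; apply: integral_ge0 => s /=.
rewrite in_itv/= => /andP[s0 st].
by rewrite lee_fin mulr_ge0 ?powR_ge0 ?ltW ?mlk_gt0.
Qed.

Lemma mlk_le_powR (t : R) : 0 < t -> e t <= t `^ (rho - 1) / Gamma rho.
Proof.
move=> t0; rewrite mlk_rec// lerBlDr lerDl mulr_ge0 ?(ltW lam_gt0)//.
exact: mlk_shift_ge0.
Qed.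

Lemma mlk1_ge0 (t : R) : 0 < t -> 0 <= E t.
Proof.
move=> t0; have := @mlk_shift_ge0 (1 - rho) t.
by rewrite subrK; apply; rewrite // subr_gt0.
Qed.

Lemma mlk1E (t : R) : 0 < t -> E t = 1 - lam * mlk rho (1 + rho) lam t.
Proof. by move=> t0; rewrite mlk_rec// subrr powRr0 Gamma1 divr1. Qed.

Lemma mlk1_le1 (t : R) : 0 < t -> E t <= 1.
Proof.
move=> t0; rewrite mlk1E// gerBl mulr_ge0 ?(ltW lam_gt0)//.
exact: mlk_shift_ge0.
Qed.

Lemma integral_mlk (t : R) : 0 < t ->
  mu.-integrable `]0, t[ (fun s => (e s)%:E) /\
  (\int[mu]_(s in `]0%R, t[) (e s)%:E = ((1 - E t) / lam)%:E)%E.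
Proof.
move=> t0; have [H1 H2] := conv_powR_mlk rho_gt0 lam ltr01 rho_gt0 t0.
have eqf : {in `]0, t[%classic, (fun s => ((t - s) `^ (1 - 1) * e s)%:E) =1 (fun s => (e s)%:E)}.
  by move=> s _; rewrite subrr powRr0 mul1r.
split; first exact: eq_integrable H1.
transitivity (\int[mu]_(s in `]0%R, t[) ((t - s) `^ (1 - 1) * e s)%:E)%E.
  by apply: eq_integral => s _; rewrite subrr powRr0 mul1r.
rewrite H2 Gamma1 mul1r mlk1E//; congr EFin.
by field; exact: lt0r_neq0.
Qed.

Lemma mlk_nonincreasing (s t : R) : 0 < s -> s <= t -> e t <= e s.
Proof.
move=> s0; rewrite le_eqVlt => /orP[/eqP ->//|st].
have t0 : 0 < t by apply: lt_trans st.
(* By scaling, monotonicity in t follows from monotonicity in lam. *)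
have F (x : R) : 0 < x ->
    mittag_leffler rho rho (- lam * x `^ rho) = mlk rho rho (lam * x `^ rho) 1.
  by move=> x0; rewrite /mlk !powR1 mul1r mulr1 mulNr.
have lt_pow : lam * s `^ rho < lam * t `^ rho.
  by rewrite ltr_pM2l// gt0_ltr_powR// nnegrE ltW.
have ms : 0 < lam * s `^ rho by rewrite mulr_gt0 ?powR_gt0.
have mt : 0 < lam * t `^ rho by rewrite mulr_gt0 ?powR_gt0.
rewrite /mlk F// F//; apply: ler_pM.
- exact: powR_ge0.
- by rewrite ltW// mlk_gt0.
- by apply: powR_neg_le => //; exact: ltW.
- exact: mlk_le_lam.
Qed.

(** As e is nonincreasing, t e(t) is at most its integral over ]0, t[, which is (1 - E t) / lam <= 1
    / lam. This bound puts u(t) in the domain of A for every phi in H. *)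
Lemma mlk_decay (t : R) : 0 < t -> lam * e t <= t^-1.
Proof.
move=> t0; have [H1 H2] := integral_mlk t0.
have e0 : 0 <= e t by rewrite ltW// mlk_gt0.
have : ((e t * t)%:E <= ((1 - E t) / lam)%:E)%E.
  rewrite -H2.
  have -> : ((e t * t)%:E = \int[mu]_(s in `]0%R, t[) (e t)%:E)%E.
    by rewrite integral_cst//= lebesgue_measure_itv/= lte_fin t0 sube0 EFinM.
  apply: ge0_le_integral.
  - exact: measurable_itv.
  - by move=> s _; rewrite lee_fin.
  - exact: measurable_cst.
  - by apply/measurable_EFinP; exact: measurable_mlk.
  - move=> s /=; rewrite in_itv/= => /andP[s0 st]; rewrite lee_fin.
    by apply: mlk_nonincreasing => //; exact: ltW.
rewrite lee_fin ler_pdivlMr// => le1.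
rewrite -[leRHS]mul1r ler_pdivlMr// (_ : lam * e t * t = e t * t * lam); last by ring.
by apply: (le_trans le1); rewrite gerBl mlk1_ge0.
Qed.

(** By [integral_mlk], E is 1 - lam times a primitive of e. The fundamental theorem of calculus
    needs continuity of e at t only, so the singularity at 0 does no harm. *)
Lemma is_derive_mlk1 (t : R) : 0 < t -> is_derive t 1 E (- (lam * e t)).
Proof.
move=> t0.
pose F x := \int[mu]_(s in `]0, x]) e s.
have me D : measurable_fun D e by apply: measurable_mlk.
have t10 : 0 < t + 1 by rewrite addr_gt0.
have int1 : mu.-integrable `]0, t + 1] (EFin \o e).
  apply/integrableP; split; first by apply/measurable_EFinP; exact: me.
  rewrite -integral_itv_bndo_bndc; last first.
    apply: measurableT_comp => //; exact/measurable_EFinP.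
  by have /integrableP[_] := (integral_mlk t10).1.
have tt1 : t < t + 1 by rewrite ltrDl.
have ax : (BRight 0 < BRight t)%O by rewrite bnd_simp.
have [dF F'] := continuous_FTC1 tt1 int1 ax (mlk_continuous rho_gt0 rho_gt0 t0).
have FE x : 0 < x -> F x = (1 - E x) / lam.
  move=> x0; rewrite /F /Rintegral -integral_itv_bndo_bndc; last first.
    by apply/measurable_EFinP; exact: me.
  by rewrite (integral_mlk x0).2.
have EF x : 0 < x -> E x = 1 - lam * F x.
  move=> x0; rewrite (FE x x0); move: (E x) => y.
  by field; exact: lt0r_neq0.
have {}F' : derive1 F t = e t by [].
have {}dF : derivable F t 1 by [].
clearbody F.
have dF' : is_derive t 1 F (e t) by split; [exact: dF|rewrite -derive1E; exact: F'].
have d1 : is_derive t 1 (fun x => 1 - lam * F x) (- (lam * e t)).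
  apply: is_derive_eq; by rewrite /GRing.scale/= add0r mul1r.
have near_eq : \forall x \near t, 1 - lam * F x = E x.
  by near=> x; rewrite EF//; near: x; exact: lt_nbhsr.
exact: (near_eq_is_derive near_eq d1).
Unshelve. all: by end_near. Qed.

Lemma mlk1_cvg0 : E t @[t --> (0:R)^'+] --> (1:R).
Proof.
have h : - lam * t `^ rho @[t --> (0:R)^'+] --> - lam * 0.
  by apply: cvgMr; exact: powR_cvg0.
rewrite mulr0 in h.
have ML0 : mittag_leffler rho 1 0 = 1 by rewrite mittag_leffler0// Gamma1 invr1.
suff : E t @[t --> (0:R)^'+] --> mittag_leffler rho 1 0 by rewrite ML0.
rewrite [X in X @ _](_ : _ = (fun t => mittag_leffler rho 1 (- lam * t `^ rho))); last first.
  by apply/funext => t; rewrite /mlk subrr powRr0 mul1r.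
apply: (@cvg_comp _ _ _ _ (mittag_leffler rho 1) _ _ _ h).
exact: mittag_leffler_continuous.
Qed.

Lemma frac_conv_mlk (t : R) : 0 < t ->
  mu.-integrable `]0, t[ (fun s => ((t - s) `^ (- rho) * e s)%:E) /\
  (\int[mu]_(s in `]0%R, t[) ((t - s) `^ (- rho) * e s)%:E =
   (Gamma (1 - rho) * E t)%:E)%E.
Proof.
move=> t0; have r0 : 0 < 1 - rho by rewrite subr_gt0.
have := conv_powR_mlk rho_gt0 lam r0 rho_gt0 t0.
by rewrite subrK (_ : 1 - rho - 1 = - rho)//; ring.
Qed.

End mlk_estimates.

(** * The scalar maximum principle *)

Section fractional_uniqueness.
Context {R : realType}.
Notation mu := (@lebesgue_measure R).
Variables (rho lam c T : R).
Hypotheses (rho_gt0 : 0 < rho) (rho_lt1 : rho < 1) (lam_gt0 : 0 < lam) (c_gt0 : 0 < c).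

Lemma is_derive_powR_sub (t x : R) : x < t ->
  is_derive x 1 (fun s => (t - s) `^ (- rho)) (rho * (t - x) `^ (- rho - 1)).
Proof.
move=> xt; have tx : 0 < t - x by rewrite subr_gt0.
have d1 : is_derive x 1 (fun s => t - s) (-1).
  by apply: is_derive_eq; rewrite ?add0r ?mul1r.
have d2 := is_derive1_powR (- rho) tx.
have := @is_derive1_comp _ _ (fun s => t - s) x _ _ d2 d1.
move=> d; apply: (is_derive_eq d).
by rewrite mulrN1 mulNr opprK.
Qed.

Lemma integrable_itv_cc (a b : R) (f : R -> R) :
  mu.-integrable `]a, b[ (EFin \o f) -> mu.-integrable `[a, b] (EFin \o f).
Proof.
move=> /integrableP[/measurable_EFinP mf intf].
have mf' := measurable_fun_itv_cc mf.
apply/integrableP; split; first exact/measurable_EFinP.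
rewrite (@integral_itv_bndoo _ a b (fun x => `|(EFin \o f) x|)%E)//.
by apply: measurableT_comp => //; exact/measurable_EFinP.
Qed.

(* Let t0 be a positive maximum of g on ]0, t0] and P x the integral of
   (t0 - s)^(- rho) z s over [0, x]. Integrating by parts with z = - g' / lam,
   the function Phi = lam P + (t0 - x)^(- rho) (g x - g t0) is nonincreasing, so
   that lam P t0 <= 0, whereas c P t0 = g t0 > 0. *)
Lemma frac_max_principle (z g : R -> R) :
  (forall t, 0 < t < T -> {for t, continuous z}) ->
  (forall t, 0 < t < T ->
    mu.-integrable `]0, t[ (fun s => ((t - s) `^ (- rho) * z s)%:E)) ->
  (forall t, 0 < t < T ->
    g t = c * \int[mu]_(s in `]0, t[) ((t - s) `^ (- rho) * z s)) ->
  (forall t, 0 < t < T -> is_derive t 1 g (- (lam * z t))) ->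
  g t @[t --> (0:R)^'+] --> (0:R) ->
  forall t, 0 < t < T -> g t <= 0.
Proof.
move=> zc intz gE dg g0 t1 /andP[t10 t1T]; rewrite leNgt; apply/negP => gt1.
have gc t : 0 < t < T -> {for t, continuous g}.
  move=> /dg [dgt _]; apply: differentiable_continuous; exact/derivable1_diffP.
(* Extrema are attained on compact intervals only. Below a the limit 0 keeps g under g t1, so a
   maximum over [a, t1] also dominates all of ]0, t0]. *)
have [t0 [t00 t01 gmax gt0]] : exists t0, [/\ 0 < t0, t0 <= t1,
    (forall s, 0 < s <= t0 -> g s <= g t0) & 0 < g t0].
  have [d /= d0 dP] := cvgr_lt _ g0 _ gt1.
  pose a := Num.min (d / 2) t1.
  have a0 : 0 < a by rewrite lt_min divr_gt0.
  have a1 : a <= t1 by rewrite ge_min lexx orbT.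
  have ad : a < d by rewrite gt_min; apply/orP; left; lra.
  have cont : {within `[a, t1], continuous g}.
    apply: continuous_in_subspaceT => x; rewrite inE/= in_itv/= => /andP[x1 x2].
    by apply: gc; rewrite (lt_le_trans a0)// (le_lt_trans x2).
  have [t0 t0in t0max] := EVT_max a1 cont.
  move: t0in; rewrite in_itv/= => /andP[at0 t01].
  have g1 : g t1 <= g t0 by apply: t0max; rewrite in_itv/= lexx a1.
  exists t0; split => //.
  - exact: lt_le_trans at0.
  - move=> s /andP[s0 st0]; have [sa|sa] := leP a s.
      by apply: t0max; rewrite in_itv/= sa (le_trans st0).
    rewrite (le_trans _ g1)// ltW//; apply: dP => //=.
    by rewrite sub0r normrN gtr0_norm// (lt_trans sa).
  - exact: lt_le_trans g1.
have t0T : t0 < T by apply: le_lt_trans t1T.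
pose K s := (t0 - s) `^ (- rho).
pose f s := K s * z s.
pose M := g t0.
have intf : mu.-integrable `[0, t0] (EFin \o f).
  by apply: integrable_itv_cc; apply: intz; rewrite t00.
pose P x := \int[mu]_(s in `[0, x]) f s.
have PM : c * P t0 = M.
  rewrite /M gE ?t00// /P -Rintegral_itv_obnd_cbnd; last first.
    by apply: integrableS intf => //; apply: subset_itvr; rewrite bnd_simp.
  rewrite -Rintegral_itv_bndo_bndc//.
  by apply: intz; rewrite t00.
pose Phi x := lam * P x + K x * (g x - M).
(* The two terms lam K z cancel; what remains has the sign of g x - M, which is nonpositive. *)
have dPhi x : 0 < x < t0 ->
    is_derive x 1 Phi (rho * (t0 - x) `^ (- rho - 1) * (g x - M)).
  move=> /andP[x0 xt0]; have xT : 0 < x < T by rewrite x0 (lt_trans xt0).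
  have dK := is_derive_powR_sub xt0.
  have cf : {for x, continuous f}.
    apply: (@continuousM R _ K); last exact: zc.
    have [dKx _] := dK.
    by apply: differentiable_continuous; exact/derivable1_diffP.
  have [dP P'] := continuous_FTC1_closed xt0 intf x0 cf.
  have dP' : is_derive x 1 P (f x) by split; [exact: dP|rewrite -derive1E; exact: P'].
  have dgx := dg _ xT.
  have d1 : is_derive x 1 (fun x => lam * P x) (lam * f x).
    by apply: is_derive_eq; rewrite /GRing.scale/=.
  have d2 : is_derive x 1 (fun x => g x - M) (- (lam * z x)).
    by apply: is_derive_eq; rewrite subr0.
  have d3 : is_derive x 1 (fun x => K x * (g x - M))
     (K x * - (lam * z x) + (g x - M) * (rho * (t0 - x) `^ (- rho - 1))).
    exact: is_deriveM.
  have d4 := is_deriveD d1 d3; apply: is_derive_eq.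
  by rewrite /f; ring.
have P0 : P x @[x --> (0:R)^'+] --> (0:R).
  apply: cvg_at_right_filter.
  by have := parameterized_integral_cvg_left t00 intf.
have Pt0 : P x @[x --> t0^'-] --> P t0.
  by have := parameterized_integral_cvg_at_left t00 intf.
(* For a < b, Phi b <= Phi a <= lam P a, because the boundary term at a is nonpositive; then a tends
   to 0. *)
have Phi_le0 b : 0 < b < t0 -> Phi b <= 0.
  move=> /andP[b0 bt0].
  have Phi_le a : 0 < a < b -> Phi b <= lam * P a.
    move=> /andP[a0 ab].
    have Phi_cont : {within `[a, b], continuous Phi}.
      apply: continuous_in_subspaceT => x; rewrite inE/= in_itv/= => /andP[ax xb].
      have [d _] : is_derive x 1 Phi (rho * (t0 - x) `^ (- rho - 1) * (g x - M)).
        by apply: dPhi; rewrite (lt_le_trans a0)// (le_lt_trans xb).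
      by apply: differentiable_continuous; exact/derivable1_diffP.
    have [|x xin Phi_eq] := @MVT _ Phi
        (fun x => rho * (t0 - x) `^ (- rho - 1) * (g x - M)) a b ab _ Phi_cont.
      move=> x; rewrite in_itv/= => /andP[ax xb].
      by apply: dPhi; rewrite (lt_trans a0)// (lt_trans xb).
    have le1 : Phi b <= Phi a.
      rewrite -subr_le0 Phi_eq pmulr_lle0 ?subr_gt0//.
      rewrite mulr_ge0_le0 ?mulr_ge0 ?powR_ge0 ?(ltW rho_gt0)//.
      move: xin; rewrite in_itv/= => /andP[ax xb]; rewrite subr_le0 gmax//.
      by rewrite (lt_trans a0)// ltW// (lt_trans xb).
    apply: (le_trans le1); rewrite /Phi gerDl mulr_ge0_le0 ?powR_ge0//.
    by rewrite subr_le0 gmax// a0 ltW// (lt_trans ab).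
  have lamP : lam * P x @[x --> (0:R)^'+] --> (0:R).
    by rewrite -[X in _ --> X](mulr0 lam); exact: cvgMr.
  apply: (cvgr_to_ge lamP).
  near=> a; apply: Phi_le; apply/andP; split; near: a.
    exact: nbhs_right_gt.
  exact: nbhs_right_lt.
(* L bounds the derivative of g near t0. By the mean value theorem the boundary term of [Phi] at b
   is at most L (t0 - b)^(1 - rho) in absolute value, which vanishes as b tends to t0 because rho <
   1. *)
pose L := lam * (`|z t0| + 1).
have t0in : 0 < t0 < T by rewrite t00.
have sub_cvg : t0 - b @[b --> t0^'-] --> (0:R)^'+.
  move=> A [d /= d0 dA]; exists d => //= b bd bt0.
  by apply: dA => /=; rewrite ?subr_gt0// sub0r normrN.
have hcvg : L * (t0 - b) `^ (1 - rho) @[b --> t0^'-] --> (0:R).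
  rewrite -[X in _ --> X](mulr0 L); apply: cvgMr.
  apply: (@cvg_comp _ _ _ _ (@powR R ^~ (1 - rho)) _ _ _ sub_cvg).
  by apply: powR_cvg0; rewrite subr_gt0.
have zbound : \forall b \near t0, `|z b| <= `|z t0| + 1.
  have [d /= d0 dP] := (cvgrPdist_lt _ _).1 (zc _ t0in) _ ltr01.
  exists d => // x xd; rewrite -lerBlDl (le_trans (lerB_dist _ _))// distrC.
  exact: ltW (dP _ xd).
have [d /= d0 dP] := zbound.
have le_lim : lam * P t0 <= 0.
  have lamP : lam * P b - L * (t0 - b) `^ (1 - rho) @[b --> t0^'-] --> lam * P t0 - 0.
    by apply: cvgB => //; exact: cvgMr.
  rewrite -[leLHS]subr0; apply: (cvgr_to_le lamP).
  near=> b; have bt0 : b < t0 by near: b; exact: nbhs_left_lt.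
  have b0 : 0 < b by near: b; exact: nbhs_left_gt.
  have bd : t0 - b < d.
    by rewrite ltrBlDr addrC -ltrBlDr; near: b; apply: nbhs_left_gt; rewrite gtrBl.
  have Pb : Phi b <= 0 by apply: Phi_le0; rewrite b0.
  have tb : 0 < t0 - b by rewrite subr_gt0.
  have gcont : {within `[b, t0], continuous g}.
    apply: continuous_in_subspaceT => x; rewrite inE/= in_itv/= => /andP[bx xt0].
    by apply: gc; rewrite (lt_le_trans b0)// (le_lt_trans xt0).
  have [|x xin g_eq] := @MVT _ g (fun x => - (lam * z x)) b t0 bt0 _ gcont.
    move=> x; rewrite in_itv/= => /andP[bx xt0].
    by apply: dg; rewrite (lt_trans b0)// (lt_trans xt0).
  move: xin; rewrite in_itv/= => /andP[bx xt0].
  have le1 : M - g b <= L * (t0 - b).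
    rewrite /M g_eq ler_wpM2r ?(ltW tb)// -mulrN /L ler_wpM2l ?(ltW lam_gt0)//.
    rewrite (le_trans (ler_norm _))// normrN; apply: dP => /=.
    rewrite gtr0_norm ?subr_gt0// (lt_trans _ bd)//.
    by rewrite ltrD2l ltrN2.
  have le2 : K b * (M - g b) <= L * (t0 - b) `^ (1 - rho).
    rewrite (le_trans (ler_wpM2l (powR_ge0 _ _) le1))// mulrCA ler_wpM2l//.
      by rewrite mulr_ge0 ?(ltW lam_gt0)// addr_ge0.
    by rewrite (gt0_powRD 1 (- rho) tb) powRr1 ?(ltW tb)// mulrC.
  move: Pb; rewrite /Phi -opprB mulrN => Pb; lra.
have : 0 < M by [].
rewrite -PM; rewrite pmulr_rgt0// => Ppos.
by move: le_lim; rewrite pmulr_rle0// leNgt Ppos.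
Unshelve. all: by end_near. Qed.

(** The maximum principle for (z, g) and for (- z, - g) gives g = 0, and then z = - g' / lam
    vanishes too. *)
Lemma frac_uniqueness (z g : R -> R) :
  (forall t, 0 < t < T -> {for t, continuous z}) ->
  (forall t, 0 < t < T ->
    mu.-integrable `]0, t[ (fun s => ((t - s) `^ (- rho) * z s)%:E)) ->
  (forall t, 0 < t < T ->
    g t = c * \int[mu]_(s in `]0, t[) ((t - s) `^ (- rho) * z s)) ->
  (forall t, 0 < t < T -> is_derive t 1 g (- (lam * z t))) ->
  g t @[t --> (0:R)^'+] --> (0:R) ->
  forall t, 0 < t < T -> z t = 0.
Proof.
move=> zc intz gE dg g0.
have gle := frac_max_principle zc intz gE dg g0.
have gge t : 0 < t < T -> - g t <= 0.
  move: t; apply: (@frac_max_principle (fun s => - z s) (fun s => - g s)).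
  - by move=> t tT; apply: continuousN; exact: zc.
  - move=> t tT; have := integrableN (intz t tT).
    by apply: eq_integrable => // s _; rewrite /= mulrN.
  - move=> t tT; rewrite gE// -mulrN; congr (_ * _).
    rewrite -mulN1r -RintegralZl//; last exact: intz.
    by apply: eq_Rintegral => s _; rewrite mulN1r mulrN.
  - by move=> t tT; have := is_deriveN (dg t tT); rewrite mulrN.
  - by rewrite -[X in _ --> X]oppr0; exact: cvgN.
move=> t tT.
have g_eq0 : \forall s \near t, cst 0 s = g s.
  move: tT => /andP[t0 t1]; near=> s.
  have sT : 0 < s < T.
    by apply/andP; split; near: s; [exact: lt_nbhsr|exact: lt_nbhsl].
  by apply/eqP; rewrite eq_le gle// andbT -oppr_le0 gge.
have d0 : is_derive t 1 g 0.
  by apply: near_eq_is_derive g_eq0 _; exact: is_derive_cst.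
have [_ e1] := dg t tT; have [_ e2] := d0.
move: e2; rewrite e1 => /eqP; rewrite oppr_eq0 mulf_eq0 gt_eqF//= => /eqP //.
Unshelve. all: by end_near. Qed.

End fractional_uniqueness.

(** * Geometry of H *)

Section scalar_kinds.
Context {R : realType} (k : scalar_kind).
Local Notation K := (scalars R k).
Local Notation sr := (@scalar_of_real R k).
Local Notation re := (@scalar_re R k).
Local Notation cj := (@scalar_conj R k).

Lemma scalar_of_realD (x y : R) : sr (x + y) = sr x + sr y.
Proof. by case: k => //=; rewrite rmorphD. Qed.

Lemma scalar_of_realM (x y : R) : sr (x * y) = sr x * sr y.
Proof. by case: k => //=; rewrite rmorphM. Qed.

Lemma scalar_of_real0 : sr 0 = 0.
Proof. by case: k. Qed.

Lemma scalar_of_real1 : sr 1 = 1.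
Proof. by case: k. Qed.

Lemma scalar_of_realN (x : R) : sr (- x) = - sr x.
Proof. by case: k => //=; rewrite rmorphN. Qed.

Lemma scalar_of_realB (x y : R) : sr (x - y) = sr x - sr y.
Proof. by rewrite scalar_of_realD scalar_of_realN. Qed.

Lemma scalar_of_real_nat (b : bool) : sr b%:R = b%:R.
Proof. by case: b; rewrite ?scalar_of_real0 ?scalar_of_real1. Qed.

Lemma scalar_of_real_norm (x : R) : `|sr x| = sr `|x|.
Proof.
by case: k => //=; rewrite normc_def/= expr0n addr0 sqrtr_sqr.
Qed.

Lemma scalar_of_real_le (x y : R) : (sr x <= sr y) = (x <= y).
Proof. by case: k => //=; rewrite lecR. Qed.

Lemma scalar_of_real_lt (x y : R) : (sr x < sr y) = (x < y).
Proof. by case: k => //=; rewrite ltcR. Qed.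

Lemma scalar_of_realK : cancel sr re.
Proof. by case: k. Qed.

Lemma scalar_reK (z : K) : 0 <= z -> sr (re z) = z.
Proof.
by case: k z => //= z z0; apply: RRe_real; exact: ger0_real.
Qed.

Lemma scalar_reD (x y : K) : re (x + y) = re x + re y.
Proof. by case: k x y => //= -[a b] [c d]. Qed.

Lemma scalar_reN (x : K) : re (- x) = - re x.
Proof. by case: k x => //= -[a b]. Qed.

Lemma scalar_re_mull (a : R) (x : K) : re (sr a * x) = a * re x.
Proof. by case: k x => //= -[b c]; rewrite /= mul0r subr0. Qed.

Lemma scalar_re_conj (x : K) : re (cj x) = re x.
Proof. by case: k x => //= -[a b]. Qed.

Lemma scalar_conj_real (x : R) : cj (sr x) = sr x.
Proof. by case: k => //=; rewrite oppr0. Qed.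

Lemma scalar_re_normM (z : K) : re (z * cj z) = re `|z| ^+ 2.
Proof.
case: k z => [z|[a b]]; first by rewrite /= real_normK ?num_real// expr2.
by rewrite /= sqr_sqrtr ?addr_ge0 ?sqr_ge0//; ring.
Qed.

End scalar_kinds.

Section real_inner_product.
Context {R : realType} {k : scalar_kind} {H : completeNormedModType (scalars R k)}.
Local Notation K := (scalars R k).
Local Notation "x %:K" := (scalar_of_real k x) (at level 2, format "x %:K").

Lemma rnormE (x : H) : `|x| = (rnorm x)%:K.
Proof. by rewrite /rnorm scalar_reK. Qed.

Lemma rnorm_ge0 (x : H) : 0 <= rnorm x.
Proof. by rewrite -(scalar_of_real_le k) scalar_of_real0 -rnormE. Qed.

Lemma rnorm_eq0 (x : H) : rnorm x = 0 -> x = 0.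
Proof.
by move=> x0; apply/eqP; rewrite -normr_eq0 rnormE x0 scalar_of_real0.
Qed.

Lemma rnorm0 : rnorm (0 : H) = 0.
Proof.
by rewrite /rnorm normr0; have := @scalar_of_realK R k 0; rewrite scalar_of_real0.
Qed.

Lemma rnormN (x : H) : rnorm (- x) = rnorm x.
Proof. by rewrite /rnorm normrN. Qed.

Lemma rnormB (x y : H) : rnorm (x - y) = rnorm (y - x).
Proof. by rewrite -opprB rnormN. Qed.

Lemma rnormD (x y : H) : rnorm (x + y) <= rnorm x + rnorm y.
Proof.
by rewrite -(scalar_of_real_le k) scalar_of_realD -!rnormE ler_normD.
Qed.

Lemma rnormZ (a : R) (x : H) : rnorm (a%:K *: x) = `|a| * rnorm x.
Proof.
apply: (can_inj (@scalar_of_realK R k)).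
by rewrite scalar_of_realM -!rnormE normrZ scalar_of_real_norm.
Qed.

Lemma rnorm_sum (I : Type) (s : seq I) (P : pred I) (f : I -> H) :
  rnorm (\sum_(i <- s | P i) f i) <= \sum_(i <- s | P i) rnorm (f i).
Proof.
elim/big_ind2 : _ => //; first by rewrite rnorm0.
by move=> x a y b xa yb; rewrite (le_trans (rnormD _ _))// lerD.
Qed.

(** The topology of H is quantified over positive elements of K; even for complex scalars these are
    real, so real radii suffice. *)
Lemma cvg_rnormP (T : Type) (F : set_system T) (FF : Filter F) (f : T -> H) (l : H) :
  f @ F --> l <-> forall e : R, 0 < e -> \forall x \near F, rnorm (l - f x) < e.
Proof.
split => [/cvgrPdist_lt fl e e0|fl].
  have : 0 < e%:K by rewrite -(scalar_of_real0 k) scalar_of_real_lt.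
  move=> /fl; apply: filterS => x.
  by rewrite rnormE scalar_of_real_lt.
apply/cvgrPdist_lt => e e0; have e' : e = (scalar_re k e)%:K by rewrite scalar_reK// ltW.
have : 0 < scalar_re k e by rewrite -(scalar_of_real_lt k) -e' scalar_of_real0.
move=> /fl; apply: filterS => x.
by rewrite rnormE [X in _ -> _ < X]e' scalar_of_real_lt.
Qed.

Lemma cvg_rnorm0P (T : Type) (F : set_system T) (FF : Filter F) (f : T -> H) (l : H) :
  f @ F --> l <-> rnorm (l - f x) @[x --> F] --> (0:R).
Proof.
split => [/cvg_rnormP fl|/cvgrPdist_lt fl].
  apply/cvgrPdist_lt => e /fl; apply: filterS => x.
  by rewrite sub0r normrN ger0_norm ?rnorm_ge0.
apply/cvg_rnormP => e /fl; apply: filterS => x.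
by rewrite sub0r normrN ger0_norm ?rnorm_ge0.
Qed.

Lemma rnorm_lip (x y : H) : `|rnorm x - rnorm y| <= rnorm (x - y).
Proof.
have h (a b : H) : rnorm a - rnorm b <= rnorm (a - b).
  by rewrite lerBlDr; have := rnormD (a - b) b; rewrite subrK.
by rewrite ler_norml h andbT lerNl opprB rnormB h.
Qed.

Lemma rnorm_cvg (T : Type) (F : set_system T) (FF : Filter F) (f : T -> H) (l : H) :
  f @ F --> l -> rnorm (f x) @[x --> F] --> rnorm l.
Proof.
move=> /cvg_rnormP fl; apply/cvgrPdist_lt => e /fl; apply: filterS => x.
exact/le_lt_trans/rnorm_lip.
Qed.

Variable ip : {dot H for @scalar_conj R k}.
Hypothesis H_ip : is_scalar_product ip.

(* The real scalar product that underlies ip. *)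
Definition rip (x y : H) : R := scalar_re k (ip x y).

Lemma ip_conj (x y : H) : ip x y = scalar_conj k (ip y x).
Proof. by rewrite (@hermitian_subproof _ _ _ _ ip x y) expr0 mul1r. Qed.

Lemma ipDl (x y z : H) : ip (x + y) z = ip x z + ip y z.
Proof.
have sub a b : ip (a - b) z = ip a z - ip b z.
  exact: (@zmod_morphisml_subproof _ _ _ _ _ _ ip z a b).
have ip0 : ip 0 z = 0 by rewrite -(subrr 0) sub subrr.
have ipN : ip (- y) z = - ip y z by rewrite -sub0r sub ip0 sub0r.
by rewrite -{1}[y]opprK sub ipN opprK.
Qed.

Lemma ipNl (x y : H) : ip (- x) y = - ip x y.
Proof.
have /eqP : ip (x - x) y = 0.
  by rewrite subrr -(subrr 0) (@zmod_morphisml_subproof _ _ _ _ _ _ ip y 0 0) subrr.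
by rewrite ipDl addrC addr_eq0 => /eqP.
Qed.

Lemma ipZl (a : K) (x y : H) : ip (a *: x) y = a * ip x y.
Proof. exact: (@linearl_subproof _ _ _ _ _ _ ip y a x). Qed.

Lemma ipZr (a : K) (x y : H) : ip x (a *: y) = scalar_conj k a * ip x y.
Proof. exact: (@linearr_subproof _ _ _ _ _ _ ip x a y). Qed.

Lemma ripC (x y : H) : rip x y = rip y x.
Proof. by rewrite /rip ip_conj scalar_re_conj. Qed.

Lemma ripDl (x y z : H) : rip (x + y) z = rip x z + rip y z.
Proof. by rewrite /rip ipDl scalar_reD. Qed.

Lemma ripZl (a : R) (x y : H) : rip (a%:K *: x) y = a * rip x y.
Proof. by rewrite /rip ipZl scalar_re_mull. Qed.

Lemma ripNl (x y : H) : rip (- x) y = - rip x y.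
Proof.
have := ripZl (- 1) x y; rewrite scalar_of_realN scalar_of_real1 scaleN1r.
by rewrite mulN1r.
Qed.

Lemma ripBl (x y z : H) : rip (x - y) z = rip x z - rip y z.
Proof. by rewrite ripDl ripNl. Qed.

Lemma ripDr (x y z : H) : rip x (y + z) = rip x y + rip x z.
Proof. by rewrite ripC ripDl ripC [rip z x]ripC. Qed.

Lemma ripZr (a : R) (x y : H) : rip x (a%:K *: y) = a * rip x y.
Proof. by rewrite ripC ripZl ripC. Qed.

Lemma ripBr (x y z : H) : rip x (y - z) = rip x y - rip x z.
Proof. by rewrite ripC ripBl ripC [rip z x]ripC. Qed.

Lemma rip_suml (I : Type) (s : seq I) (P : pred I) (f : I -> H) y :
  rip (\sum_(i <- s | P i) f i) y = \sum_(i <- s | P i) rip (f i) y.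
Proof.
have rip0 : rip 0 y = 0 by have := ripBl 0 0 y; rewrite !subrr.
by elim/big_rec2 : _ => // i a b _ <-; rewrite ripDl.
Qed.

Lemma rip_sumr (I : Type) (s : seq I) (P : pred I) (f : I -> H) y :
  rip y (\sum_(i <- s | P i) f i) = \sum_(i <- s | P i) rip y (f i).
Proof. by rewrite ripC rip_suml; apply: eq_bigr => i _; rewrite ripC. Qed.

Lemma rip_rnorm (x : H) : rip x x = rnorm x ^+ 2.
Proof.
apply: (can_inj (@scalar_of_realK R k)); rewrite /rip H_ip scalar_reK ?exprn_ge0//.
by rewrite rnormE !expr2 scalar_of_realM.
Qed.

Lemma rnormD_sqr (x y : H) :
  rnorm (x + y) ^+ 2 = rnorm x ^+ 2 + 2 * rip x y + rnorm y ^+ 2.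
Proof.
rewrite -!rip_rnorm ripDl !ripDr [rip y x]ripC; ring.
Qed.

Lemma rip_cauchy_schwarz (x y : H) : `|rip x y| <= rnorm x * rnorm y.
Proof.
rewrite -(@ler_pXn2r _ 2) ?nnegrE ?mulr_ge0 ?rnorm_ge0// real_normK ?num_real//.
rewrite exprMn; have [y0|y0] := eqVneq (rnorm y) 0.
  rewrite (rnorm_eq0 y0) rnorm0 expr0n/= mulr0.
  by rewrite ripC (_ : 0 = (0:R)%:K *: 0) ?ripZl ?mul0r ?expr0n// scaler0.
have yp : 0 < rnorm y ^+ 2 by rewrite exprn_gt0// lt_def y0 rnorm_ge0.
(* The value of t that minimizes the norm of x + t y. *)
pose t := - (rip x y / rnorm y ^+ 2).
have := sqr_ge0 (rnorm (x + t%:K *: y)).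
rewrite rnormD_sqr ripZr rnormZ exprMn real_normK ?num_real//.
set q := (X in 0 <= X) => q0.
have : 0 <= q * rnorm y ^+ 2 by rewrite mulr_ge0// ltW.
have -> : q * rnorm y ^+ 2 = rnorm x ^+ 2 * rnorm y ^+ 2 - rip x y ^+ 2.
  by rewrite /q /t; field.
by rewrite subr_ge0.
Qed.

Lemma rip_cvg (T : Type) (F : set_system T) (FF : Filter F) (f : T -> H) (l y : H) :
  f @ F --> l -> rip (f x) y @[x --> F] --> rip l y.
Proof.
move=> /cvg_rnorm0P fl; apply/cvgrPdist_le => e e0.
have fly : rnorm (l - f x) * rnorm y @[x --> F] --> (0:R).
  have := @cvgMr_tmp R T F FF _ _ (rnorm y) fl; rewrite mul0r; exact.
move/cvgrPdist_le : fly => /(_ e e0); apply: filterS => x.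
rewrite sub0r normrN -ripBl; apply: le_trans.
by rewrite (le_trans (rip_cauchy_schwarz _ _))// ler_norm.
Qed.

End real_inner_product.

(** * Fourier expansions in a complete orthonormal system *)

Section orthonormal_expansion.
Context {R : realType} {k : scalar_kind} {H : completeNormedModType (scalars R k)}.
Local Notation K := (scalars R k).
Local Notation "x %:K" := (scalar_of_real k x) (at level 2, format "x %:K").
Variables (ip : {dot H for @scalar_conj R k}) (v : nat -> H).
Hypotheses (H_ip : is_scalar_product ip) (v_on : complete_orthonormal_system ip v).

Definition fourier_term (x : H) (j : nat) : H := ip x (v j) *: v j.

Lemma ip_suml (I : Type) (s : seq I) (P : pred I) (f : I -> H) y :
  ip (\sum_(i <- s | P i) f i) y = \sum_(i <- s | P i) ip (f i) y.
Proof.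
have ip0 : ip 0 y = 0 by rewrite -(scale0r 0) ipZl mul0r.
by elim/big_rec2 : _ => // i a b _ <-; rewrite ipDl.
Qed.

Lemma rip_fourier_term (x : H) (c : K) i j :
  i != j -> rip ip (fourier_term x i) (c *: v j) = 0.
Proof.
move=> ij; rewrite /rip ipZl ipZr v_on.1 (negbTE ij) !mulr0.
by rewrite -(scalar_of_real0 k) scalar_of_realK.
Qed.

Lemma rip_fourier_term_orth (x y : H) i j : i != j ->
  rip ip (fourier_term x i) (fourier_term y j) = 0.
Proof. exact: rip_fourier_term. Qed.

Lemma rip_expansion_rest (x : H) (c : K) i n : (i < n)%N ->
  rip ip (x - series (fourier_term x) n) (c *: v i) = 0.
Proof.
move=> i_lt; rewrite /rip ipZr.
have -> : ip (x - series (fourier_term x) n) (v i) = 0.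
  rewrite ipDl ipNl ip_suml (bigD1_seq i) ?mem_index_iota ?iota_uniq//=.
  rewrite big1 => [|j ji]; last by rewrite ipZl v_on.1 (negbTE ji) mulr0.
  by rewrite ipZl v_on.1 eqxx mulr1 addr0 subrr.
by rewrite mulr0 -(scalar_of_real0 k) scalar_of_realK.
Qed.

(** The partial sum is the orthogonal projection of x onto the span of the first n vectors, so
    Pythagoras applies. Convergence of the expansion then follows from the density of the span. *)
Lemma expansion_best_approx (x : H) (c : nat -> K) m n : (m <= n)%N ->
  rnorm (x - series (fourier_term x) n) <= rnorm (x - \sum_(i < m) c i *: v i).
Proof.
move=> mn; set y := \sum_(i < m) _.
rewrite -(@ler_pXn2r _ 2) ?nnegrE ?rnorm_ge0//.
have -> : x - y = (x - series (fourier_term x) n) + (series (fourier_term x) n - y).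
  by rewrite addrA subrK.
rewrite (rnormD_sqr H_ip (x - _) (_ - y)).
have -> : rip ip (x - series (fourier_term x) n) (series (fourier_term x) n - y) = 0.
  rewrite ripBr.
  rewrite !rip_sumr big_nat_cond big1 => [|j]; last first.
    by rewrite andbT => jn; exact: rip_expansion_rest.
  rewrite big1 => [|j _]; last by apply: rip_expansion_rest; exact: leq_trans mn.
  by rewrite subrr.
by rewrite mulr0 addr0 lerDl sqr_ge0.
Qed.

Lemma expansion_cvg (x : H) : series (fourier_term x) @ \oo --> x.
Proof.
apply/cvg_rnormP => e e0.
have [_ /(_ (ball x e%:K))] := v_on; case.
- by exists x; apply: ballxx; rewrite -(scalar_of_real0 k) scalar_of_real_lt.
- exact: ball_open.
move=> y [xy [m [c yE]]].
pose c' i := if insub i is Some o then c o else 0.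
have yE' : y = \sum_(i < m) c' i *: v i.
  by rewrite yE; apply: eq_bigr => i _; rewrite /c' valK.
exists m => // n /= mn; rewrite (le_lt_trans (expansion_best_approx x c' mn))//.
by move: xy; rewrite -ball_normE/= rnormE scalar_of_real_lt -yE'.
Qed.

(** The scalar c makes up for taking real parts: c proportional to [ip x (v j)] gives a multiple of
    its squared modulus. The bound on the test vectors matches [bochner_integral_weak]. *)
Lemma rip_eq0_all (x : H) :
  (forall j (c : K), rnorm (c *: v j) <= 1 -> rip ip x (c *: v j) = 0) -> x = 0.
Proof.
move=> x0; suff c0 j : fourier_term x j = 0.
  have : series (fourier_term x) @ \oo --> x by exact: expansion_cvg.
  rewrite (_ : series (fourier_term x) = fun=> 0); last first.
    by apply/funext => n; rewrite /series/= big1.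
  by move=> /cvg_lim <- //; rewrite lim_cst.
have rv : rnorm (v j) = 1.
  apply/eqP; rewrite -sqrp_eq1 ?rnorm_ge0// -(rip_rnorm H_ip) /rip v_on.1 eqxx.
  by rewrite -(scalar_of_real1 k) scalar_of_realK.
pose r := rnorm (fourier_term x j).
have r0 : 0 <= r by exact: rnorm_ge0.
(* Scales the test vector, of norm r, down to norm r / (r + 1) <= 1. *)
pose d := (r + 1)^-1.
have d0 : 0 < d by rewrite invr_gt0 ltr_wpDl.
have := x0 j (d%:K * ip x (v j)); rewrite -scalerA -/(fourier_term x j) rnormZ gtr0_norm//.
rewrite -/r mulrC ler_pdivrMr ?ltr_wpDl// mul1r lerDl ler01 => /(_ isT).
rewrite ripZr => /eqP; rewrite mulf_eq0 gt_eqF//= => /eqP h.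
apply: rnorm_eq0; apply/eqP; rewrite -sqrf_eq0 -(rip_rnorm H_ip); apply/eqP.
rewrite -[RHS]h /rip /fourier_term !ipZr !ipZl v_on.1 eqxx mulr1.
by rewrite mulrC.
Qed.

End orthonormal_expansion.

Lemma cvg_sum_real (R : realType) (T : Type) (F : set_system T) (FF : Filter F)
    (f : nat -> T -> R) (l : nat -> R) n :
  (forall j, f j s @[s --> F] --> l j) ->
  \sum_(0 <= j < n) f j s @[s --> F] --> \sum_(0 <= j < n) l j.
Proof.
move=> fl; elim: n => [|n ih].
  rewrite big_geq// (_ : (fun s => _) = fun=> 0); first exact: cvg_cst.
  by apply/funext => s; rewrite big_geq.
rewrite big_nat_recr//= (_ : (fun s => _) =
  (fun s => \sum_(0 <= j < n) f j s + f n s)); first exact: cvgD.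
by apply/funext => s; rewrite big_nat_recr.
Qed.

(** * Bounded multipliers on a convergent orthogonal series *)

Section multipliers.
Context {R : realType} {k : scalar_kind} {H : completeNormedModType (scalars R k)}.
Local Notation K := (scalars R k).
Local Notation "x %:K" := (scalar_of_real k x) (at level 2, format "x %:K").
Variables (ip : {dot H for @scalar_conj R k}) (w : nat -> H) (phi : H).
Hypotheses (H_ip : is_scalar_product ip)
  (w_orth : forall i j, i != j -> rip ip (w i) (w j) = 0)
  (w_cvg : series w @ \oo --> phi).

(** The functional calculus of a diagonal operator applied to phi, with the coordinates of phi
    absorbed into w. It is meaningful for bounded m, where the series converges. *)
Definition multiplier (m : nat -> R) : H := lim (series (fun j => (m j)%:K *: w j) @ \oo).

Lemma rnorm_sum_orth (m : nat -> R) a b :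
  rnorm (\sum_(a <= j < b) (m j)%:K *: w j) ^+ 2 =
  \sum_(a <= j < b) m j ^+ 2 * rnorm (w j) ^+ 2.
Proof.
rewrite -(rip_rnorm H_ip) rip_suml; apply: eq_big_nat => i iab.
rewrite rip_sumr (bigD1_seq i) ?mem_index_iota ?iota_uniq//= big1 => [|j ji].
  by rewrite addr0 ripZl ripZr (rip_rnorm H_ip) mulrA expr2.
by rewrite ripZl ripZr w_orth ?mulr0// eq_sym.
Qed.

Lemma rnorm_sum_orth_le (m m' : nat -> R) a b :
  (forall j, `|m j| <= m' j) ->
  rnorm (\sum_(a <= j < b) (m j)%:K *: w j) <=
  rnorm (\sum_(a <= j < b) (m' j)%:K *: w j).
Proof.
move=> mm; rewrite -(@ler_pXn2r _ 2) ?nnegrE ?rnorm_ge0// !rnorm_sum_orth.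
apply: ler_sum => j _; rewrite ler_wpM2r ?sqr_ge0//.
by rewrite -real_normK ?num_real// lerXn2r ?nnegrE// (le_trans _ (mm j)).
Qed.

(** Each block is compared with the same block of w, so the Cauchy criterion for w carries over to
    the multiplied series, and tails are controlled by those of phi. *)
Lemma rnorm_sum_bounded (m : nat -> R) C a b : (forall j, `|m j| <= C) ->
  rnorm (\sum_(a <= j < b) (m j)%:K *: w j) <= C * rnorm (\sum_(a <= j < b) w j).
Proof.
move=> mC; have C0 : 0 <= C by apply: le_trans (mC 0%N).
apply: (le_trans (rnorm_sum_orth_le a b mC)).
by rewrite -scaler_sumr rnormZ ger0_norm.
Qed.

Lemma multiplier_cvg (m : nat -> R) C : (forall j, `|m j| <= C) ->
  series (fun j => (m j)%:K *: w j) @ \oo --> multiplier m.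
Proof.
move=> mC; have C0 : 0 <= C by apply: le_trans (mC 0%N).
apply: cvgP => //.
apply/cauchy_cvgP/cauchy_seriesP => e e0.
have e0' : 0 < scalar_re k e by rewrite -(scalar_of_real_lt k) scalar_of_real0 scalar_reK// ltW.
have /cauchy_cvgP/cauchy_seriesP : cvg (series w @ \oo) by apply: cvgP w_cvg.
move=> /(_ (scalar_re k e / (C + 1))%:K).
rewrite -(scalar_of_real0 k) scalar_of_real_lt divr_gt0 ?ltr_wpDl// => /(_ isT).
have eE : e = (scalar_re k e)%:K by rewrite scalar_reK// ltW.
apply: filterS => n; rewrite rnormE scalar_of_real_lt => h.
rewrite rnormE [ltRHS]eE scalar_of_real_lt.
rewrite (le_lt_trans (rnorm_sum_bounded _ _ mC))//.
apply: (@le_lt_trans _ _ ((C + 1) * rnorm (\sum_(n.1 <= j < n.2) w j))).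
  by rewrite ler_wpM2r ?rnorm_ge0// lerDl.
by rewrite mulrC -ltr_pdivlMr// ltr_wpDl.
Qed.

Lemma multiplier_tail (m : nat -> R) C n : (forall j, `|m j| <= C) ->
  rnorm (multiplier m - series (fun j => (m j)%:K *: w j) n) <=
  C * rnorm (phi - series w n).
Proof.
move=> mC; rewrite -subr_ge0.
have cv : C * rnorm (series w N - series w n) -
    rnorm (series (fun j => (m j)%:K *: w j) N -
           series (fun j => (m j)%:K *: w j) n) @[N --> \oo] -->
    C * rnorm (phi - series w n) -
    rnorm (multiplier m - series (fun j => (m j)%:K *: w j) n).
  apply: cvgB.
    apply: cvgMr; apply: rnorm_cvg; apply: cvgB => //; exact: cvg_cst.
  apply: rnorm_cvg; apply: cvgB; [exact: multiplier_cvg mC|exact: cvg_cst].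
apply: (cvgr_to_ge cv); exists n => // N /= nN.
by rewrite !sub_series_geq// subr_ge0 rnorm_sum_bounded.
Qed.

Lemma rnorm_multiplier_le (m : nat -> R) C : (forall j, `|m j| <= C) ->
  rnorm (multiplier m) <= C * rnorm phi.
Proof.
by move=> /(@multiplier_tail m C 0); rewrite /series/= !big_geq// !subr0.
Qed.

Lemma multiplierB (m m' : nat -> R) C : (forall j, `|m j| <= C) -> (forall j, `|m' j| <= C) ->
  multiplier (fun j => m j - m' j) = multiplier m - multiplier m'.
Proof.
move=> mC mC'; apply/cvg_lim => //.
rewrite (_ : series _ = (fun n => series (fun j => (m j)%:K *: w j) n -
                                  series (fun j => (m' j)%:K *: w j) n)).
  by apply: cvgB; [exact: multiplier_cvg mC|exact: multiplier_cvg mC'].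
apply/funext => n; rewrite /series/= -sumrB; apply: eq_bigr => j _.
by rewrite scalar_of_realB scalerBl.
Qed.

Lemma multiplierZ (a : R) (m : nat -> R) C : (forall j, `|m j| <= C) ->
  multiplier (fun j => a * m j) = a%:K *: multiplier m.
Proof.
move=> mC; apply/cvg_lim => //.
rewrite (_ : series _ = (fun n => a%:K *: series (fun j => (m j)%:K *: w j) n)).
  by apply: cvgZl_tmp; exact: multiplier_cvg mC.
apply/funext => n; rewrite /series/= scaler_sumr; apply: eq_bigr => j _.
by rewrite scalar_of_realM scalerA.
Qed.

Lemma multiplier1 : multiplier (fun=> 1) = phi.
Proof.
apply/cvg_lim => //; rewrite (_ : (fun j => _) = w)//.
by apply/funext => j; rewrite scalar_of_real1 scale1r.
Qed.

(** A dominated convergence theorem: the tail of the difference is small uniformly in s by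
    [multiplier_tail], and the head is a finite sum. The filter is arbitrary so as to cover
    sequences, one-sided limits and difference quotients. *)
Lemma multiplier_cvg_pointwise (T : Type) (F : set_system T) (FF : Filter F)
    (m : T -> nat -> R) (m' : nat -> R) C :
  (\forall s \near F, forall j, `|m s j| <= C) -> (forall j, `|m' j| <= C) ->
  (forall j, m s j @[s --> F] --> m' j) ->
  multiplier (m s) @[s --> F] --> multiplier m'.
Proof.
move=> mC mC' mm; have C0 : 0 <= C by apply: le_trans (mC' 0%N).
apply/cvg_rnormP => e e0.
have [n ntail] : exists n, (2 * C + 1) * rnorm (phi - series w n) < e / 2.
  have e2 : 0 < e / 2 / (2 * C + 1) by rewrite !divr_gt0// ltr_wpDl// mulr_ge0.
  have [N _ hN] := (cvg_rnormP _ _ _).1 w_cvg _ e2.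
  exists N; rewrite mulrC -ltr_pdivlMr; first exact: hN (leqnn N).
  by rewrite ltr_wpDl// mulr_ge0.
have fin : \sum_(0 <= j < n) `|m' j - m s j| * rnorm (w j) @[s --> F] --> (0:R).
  have := @cvg_sum_real R T F FF (fun j s => `|m' j - m s j| * rnorm (w j)) (fun=> 0) n.
  rewrite [X in _ --> X]big1//; apply => j.
  rewrite -[X in _ --> X](mul0r (rnorm (w j))); apply: cvgMl.
  rewrite -(normr0 R) -(subrr (m' j)); apply: cvg_norm.
  by apply: cvgB => //; exact: cvg_cst.
have e2 : 0 < e / 2 by rewrite divr_gt0.
move/cvgrPdist_lt : fin => /(_ _ e2).
apply: filterS2 mC => s mC; rewrite sub0r normrN ger0_norm; last first.
  by apply: sumr_ge0 => j _; rewrite mulr_ge0 ?rnorm_ge0.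
move=> fin_lt.
pose d j := m' j - m s j.
have d2C j : `|d j| <= 2 * C.
  by rewrite (le_trans (ler_normB _ _))// mulr_natl mulr2n lerD.
rewrite -(multiplierB mC' mC) -/d.
rewrite -[multiplier d](subrK (series (fun j => (d j)%:K *: w j) n)).
rewrite (le_lt_trans (rnormD _ _))// [ltRHS](splitr e) ltr_leD//.
  apply: le_lt_trans (multiplier_tail n d2C) _.
  apply: le_lt_trans ntail; rewrite ler_wpM2r ?rnorm_ge0// lerDl//.
rewrite (le_trans _ (ltW fin_lt))// (le_trans (rnorm_sum _ _ _))//.
by apply: ler_sum => j _; rewrite rnormZ.
Qed.

(** By orthogonality the norm of a partial sum is the square root of a finite sum of real functions,
    so measurability is a real matter. *)
Lemma measurable_rnorm_multiplier d (X : measurableType d) (D : set X) (m : X -> nat -> R)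
    (C : X -> R) :
  (forall x, D x -> forall j, `|m x j| <= C x) ->
  (forall j, measurable_fun D (fun x => m x j)) ->
  measurable_fun D (fun x => rnorm (multiplier (m x))).
Proof.
move=> mC mm.
apply: (@measurable_fun_cvg _ _ _ _ (fun n x =>
    rnorm (series (fun j => (m x j)%:K *: w j) n))); last first.
  by move=> x Dx; apply: rnorm_cvg; apply: multiplier_cvg (mC x Dx).
move=> n.
rewrite (_ : (fun x => _) = (fun x => Num.sqrt
    (\sum_(0 <= j < n) m x j ^+ 2 * rnorm (w j) ^+ 2))); last first.
  by apply/funext => x; rewrite -rnorm_sum_orth sqrtr_sqr ger0_norm// rnorm_ge0.
apply: measurableT_comp; first exact: continuous_measurable_fun (@sqrt_continuous _).
apply: measurable_sum => j; apply: measurable_funM => //.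
exact: measurable_funX.
Qed.

End multipliers.

(** * Bochner integrals *)

Section simple_maps.
Context {R : realType} {k : scalar_kind} {H : completeNormedModType (scalars R k)}.
Context {d : measure_display} {X : measurableType d}.
Local Notation K := (scalars R k).
Local Notation "x %:K" := (scalar_of_real k x) (at level 2, format "x %:K").
Variables (mu : {measure set X -> \bar R}) (D : set X).
Hypothesis mD : measurable D.

(* Holds for arbitrary functions: the integral of a nonnegative function is
   always the supremum over the simple functions below it. *)
Lemma ge0_le_lower_integral (f g : X -> \bar R) :
  (forall x, D x -> 0 <= f x)%E -> (forall x, D x -> f x <= g x)%E ->
  (\int[mu]_(x in D) f x <= \int[mu]_(x in D) g x)%E.
Proof.
move=> f0 fg; have g0 x : D x -> (0 <= g x)%E.
  by move=> Dx; exact: le_trans (f0 x Dx) (fg x Dx).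
rewrite !ge0_integralE//; apply: le_ereal_sup => _ [h hf <-]; exists h => // x.
apply: (le_trans (hf x)); rewrite !patchE; case: ifP => // /set_mem.
exact: fg.
Qed.

Lemma integral_simple n (A : 'I_n -> set X) (r : 'I_n -> R) :
  (forall i, measurable (A i)) -> (forall i, mu (A i) < +oo)%E ->
  mu.-integrable D (fun x => (\sum_i \1_(A i) x * r i)%:E) /\
  (\int[mu]_(x in D) (\sum_i \1_(A i) x * r i)%:E =
   (\sum_i fine (mu (A i `&` D)) * r i)%:E)%E.
Proof.
move=> mA fA.
have fAD i : (mu (A i `&` D) < +oo)%E.
  by apply: le_lt_trans (fA i); apply: le_measure => //; rewrite inE//; exact: measurableI.
have int_i i : mu.-integrable D (fun x => ((r i)%:E * (\1_(A i) x)%:E)%E).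
  apply: integrableZl => //; apply/integrableP; split.
    by apply/measurable_EFinP; exact: measurable_indic.
  by under eq_integral do rewrite gee0_abs ?lee_fin//; rewrite integral_indic.
have eqf : (fun x => (\sum_i \1_(A i) x * r i)%:E) =
    (fun x => \sum_(i < n) ((r i)%:E * (\1_(A i) x)%:E))%E.
  by apply/funext => x; rewrite -sumEFin; apply: eq_bigr => i _; rewrite EFinM muleC.
split; first by rewrite eqf; exact: integrable_sum.
under eq_integral => x _ do rewrite (congr1 (fun f => f x) eqf).
rewrite integral_sum// -sumEFin; apply: eq_bigr => i _.
rewrite integralZl//; last first.
  apply/integrableP; split.
    by apply/measurable_EFinP; exact: measurable_indic.
  by under eq_integral do rewrite gee0_abs ?lee_fin//; rewrite integral_indic.
rewrite integral_indic// muleC EFinM fineK// ge0_fin_numE//.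
Qed.

Lemma simple_map_cat (s1 s2 : @simple_map R k H d X mu) :
  exists s : @simple_map R k H d X mu,
    (forall x, sm_fun s x = sm_fun s1 x + sm_fun s2 x) /\
    sm_integral D s = sm_integral D s1 + sm_integral D s2.
Proof.
pose n1 := sm_size s1; pose n2 := sm_size s2.
pose A (i : 'I_(n1 + n2)) : set X :=
  match fintype.split i with inl a => sm_set a | inr b => sm_set b end.
pose c (i : 'I_(n1 + n2)) : H :=
  match fintype.split i with inl a => sm_val a | inr b => sm_val b end.
have mA i : measurable (A i) by rewrite /A; case: fintype.split => ?; exact: sm_measurable.
have fA i : (mu (A i) < +oo)%E by rewrite /A; case: fintype.split => ?; exact: sm_finite.
exists (@SimpleMap R k H d X mu _ A c mA fA); split => [x|];
  rewrite /sm_fun /sm_integral/= big_split_ord/=; congr (_ + _);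
  apply: eq_bigr => i _; rewrite /A /c.
- by rewrite (unsplitK (inl i)).
- by rewrite (unsplitK (inr i)).
- by rewrite (unsplitK (inl i)).
- by rewrite (unsplitK (inr i)).
Qed.

Import HBNNSimple.

Lemma simple_map_nnsfun (h : {nnsfun X >-> R}) (c : H) : (mu D < +oo)%E ->
  exists s : @simple_map R k H d X mu,
    (forall x, D x -> sm_fun s x = (h x)%:K *: c) /\
    sm_integral D s = (fine (\int[mu]_(x in D) (h x)%:E))%:K *: c.
Proof.
move=> fD.
pose r : seq R := finmap.enum_fset (fset_set (range h)).
(* Level sets of h may have infinite measure; cutting them with D meets the finiteness condition of
   [simple_map], at the price of a formula valid on D only. *)
pose A (i : 'I_(size r)) : set X := h @^-1` [set nth 0 r i] `&` D.
pose C (i : 'I_(size r)) : H := (nth 0 r i)%:K *: c.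
have mA i : measurable (A i) by apply: measurableI.
have fA i : (mu (A i) < +oo)%E.
  by apply: le_lt_trans fD; apply: le_measure; rewrite ?inE//; exact: subIsetr.
have hE x : D x -> h x = \sum_i \1_(A i) x * nth 0 r i.
  move=> Dx; rewrite [LHS]fimfunE fsbig_finite//= (big_nth 0) big_mkord.
  apply: eq_bigr => i _; rewrite mulrC; congr (_ * _).
  by rewrite /A !indicE in_setI (mem_set Dx) andbT.
exists (@SimpleMap R k H d X mu _ A C mA fA); split.
  move=> x Dx; rewrite hE// /sm_fun/= (big_morph _ (@scalar_of_realD R k) (scalar_of_real0 _)).
  rewrite scaler_suml; apply: eq_bigr => i _.
  by rewrite /C scalerA scalar_of_realM indicE scalar_of_real_nat.
have -> : (\int[mu]_(x in D) (h x)%:E = \int[mu]_(x in D) (\sum_i \1_(A i) x * nth 0 r i)%:E)%E.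
  by apply: eq_integral => x /set_mem Dx; rewrite hE.
rewrite (integral_simple _ mA fA).2/=.
rewrite (big_morph _ (@scalar_of_realD R k) (scalar_of_real0 _)) scaler_suml.
by apply: eq_bigr => i _; rewrite /C scalerA scalar_of_realM.
Qed.

Lemma simple_map_sum (w : nat -> H) (h : nat -> {nnsfun X >-> R}) n : (mu D < +oo)%E ->
  exists s : @simple_map R k H d X mu,
    (forall x, D x -> sm_fun s x = \sum_(0 <= j < n) (h j x)%:K *: w j) /\
    sm_integral D s =
      \sum_(0 <= j < n) (fine (\int[mu]_(x in D) (h j x)%:E))%:K *: w j.
Proof.
move=> fD; elim: n => [|n [s1 [s1f s1i]]].
  have A0 (i : 'I_0) : measurable (set0 : set X) by [].
  have f0 (i : 'I_0) : (mu (set0 : set X) < +oo)%E by rewrite measure0.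
  exists (@SimpleMap R k H d X mu 0 (fun=> set0) (fun=> 0) A0 f0).
  by split => [x Dx|]; rewrite big_geq// /sm_fun /sm_integral big_ord0.
have [s2 [s2f s2i]] := simple_map_nnsfun (h n) (w n) fD.
have [s [sf si]] := simple_map_cat s1 s2.
exists s; split => [x Dx|]; first by rewrite sf s1f// s2f// big_nat_recr.
by rewrite si s1i s2i big_nat_recr.
Qed.

Variable ip : {dot H for @scalar_conj R k}.
Hypothesis H_ip : is_scalar_product ip.

(* The functions [rip ip ^~ y] turn the strong integral into Lebesgue integrals
   of real functions. *)
Lemma bochner_integral_weak (f : X -> H) (u y : H) :
  is_bochner_integral mu D f u -> rnorm y <= 1 ->
  measurable_fun D (fun x => rip ip (f x) y) ->
  mu.-integrable D (fun x => (rip ip (f x) y)%:E) /\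
  (\int[mu]_(x in D) (rip ip (f x) y)%:E = (rip ip u y)%:E)%E.
Proof.
move=> [s [_ L1 su]] y1 mf.
pose a n x := rip ip (sm_fun (s n) x) y.
have aE n x : a n x = \sum_i \1_(@sm_set _ _ _ _ _ _ (s n) i) x * rip ip (sm_val i) y.
  rewrite /a /sm_fun rip_suml; apply: eq_bigr => i _.
  by rewrite indicE -(scalar_of_real_nat k) ripZl.
have aint n : mu.-integrable D (fun x => (a n x)%:E) /\
    (\int[mu]_(x in D) (a n x)%:E = (rip ip (sm_integral D (s n)) y)%:E)%E.
  have [I1 I2] := integral_simple (fun i => rip ip (@sm_val _ _ _ _ _ _ (s n) i) y)
    (@sm_measurable _ _ _ _ _ _ (s n)) (@sm_finite _ _ _ _ _ _ (s n)).
  have aE' : (fun x => (a n x)%:E) =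
      (fun x => (\sum_i \1_(@sm_set _ _ _ _ _ _ (s n) i) x * rip ip (sm_val i) y)%:E).
    by apply/funext => x; rewrite aE.
  rewrite aE'; split => //; rewrite I2 /sm_integral rip_suml.
  by congr EFin; apply: eq_bigr => i _; rewrite ripZl.
pose b n := (\int[mu]_(x in D) `|(rip ip (f x) y - a n x)%:E|)%E.
(* The norm on the right is not known to be measurable, hence the comparison of lower integrals. *)
have bL1 n : (b n <= \int[mu]_(x in D) (rnorm (f x - sm_fun (s n) x))%:E)%E.
  apply: ge0_le_lower_integral => x Dx //.
  rewrite lee_fin /a -ripBl (le_trans (rip_cauchy_schwarz H_ip _ _))//.
  by rewrite ler_piMr ?rnorm_ge0.
have b0 : b @ \oo --> 0%E.
  apply: (@squeeze_cvge _ _ _ _ (cst 0%E) _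
    (fun n => \int[mu]_(x in D) (rnorm (f x - sm_fun (s n) x))%:E)%E) => //.
    by apply: nearW => n; rewrite bL1 andbT; apply: integral_ge0.
  exact: cvg_cst.
have b_lt e : 0 < e -> \forall n \near \oo, (b n < e%:E)%E.
  move=> e0; apply: (b0 [set x | (x < e%:E)%E]).
  by apply: open_ereal_lt'; rewrite lte_fin.
have mfa n : measurable_fun D (fun x => (rip ip (f x) y - a n x)%:E).
  apply/measurable_EFinP; apply: measurable_funB => //.
  exact/measurable_EFinP/(measurable_int _ (aint n).1).
(* One n at distance less than 1 suffices: the paired f is the sum of its difference with [a n] and
   of [a n], both integrable. *)
have fint : mu.-integrable D (fun x => (rip ip (f x) y)%:E).
  have := b_lt 1 ltr01.
  move=> [n _ /(_ n (leqnn n)) bn].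
  have : mu.-integrable D (fun x => (rip ip (f x) y - a n x)%:E + (a n x)%:E)%E.
    apply: integrableD => //; last exact: (aint n).1.
    by apply/integrableP; split => //; rewrite (lt_trans bn)// ltry.
  by apply: eq_integrable => // x _; rewrite -EFinD subrK.
split => //.
have fin_f : (\int[mu]_(x in D) (rip ip (f x) y)%:E)%E \is a fin_num.
  exact: integrable_fin_num.
rewrite -(fineK fin_f); congr EFin.
set I := fine _.
have cv : rip ip (sm_integral D (s n)) y @[n --> \oo] --> I.
  apply/cvgrPdist_le => e e0.
  have := b_lt e e0.
  apply: filterS => n bn; rewrite -lee_fin; apply: le_trans (ltW bn).
  have [a1 a2] := aint n.
  have IE : (I - rip ip (sm_integral D (s n)) y)%:E =
      (\int[mu]_(x in D) ((rip ip (f x) y)%:E - (a n x)%:E))%E.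
    by rewrite integralB// a2 EFinB /I fineK.
  rewrite -[leLHS]/(`|(I - rip ip (sm_integral D (s n)) y)%:E|)%E IE.
  exact: (le_abse_integral mu mD (mfa n)).
have cv2 : rip ip (sm_integral D (s n)) y @[n --> \oo] --> rip ip u y.
  exact: rip_cvg.
by rewrite -(cvg_lim _ cv)// (cvg_lim _ cv2).
Qed.

End simple_maps.

Section bochner_multiplier.
Context {R : realType} {k : scalar_kind} {H : completeNormedModType (scalars R k)}.
Context {d : measure_display} {X : measurableType d}.
Local Notation "x %:K" := (scalar_of_real k x) (at level 2, format "x %:K").
Variables (mu : {measure set X -> \bar R}) (D : set X).
Hypotheses (mD : measurable D) (fD : (mu D < +oo)%E).
Variables (ip : {dot H for @scalar_conj R k}) (w : nat -> H) (phi : H).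
Hypotheses (H_ip : is_scalar_product ip)
  (w_orth : forall i j, i != j -> rip ip (w i) (w j) = 0)
  (w_cvg : series w @ \oo --> phi).

Lemma multiplier_finite (m : nat -> R) n :
  multiplier w (fun j => if (j < n)%N then m j else 0) = \sum_(0 <= j < n) (m j)%:K *: w j.
Proof.
apply/cvg_lim => //; apply: cvg_near_cst; exists n => // N /= nN.
rewrite /series/= (big_cat_nat _ nN)//= [X in _ + X](_ : _ = 0); last first.
  rewrite big_nat_cond big1 // => j /andP[/andP[nj _] _].
  by rewrite ltnNge nj/= scalar_of_real0 scale0r.
by rewrite addr0; apply: eq_big_nat => j /andP[_ ->].
Qed.

Import HBNNSimple.

(** The integral is taken coordinatewise. Both the values and the integrals of the approximants
    converge by [multiplier_cvg_pointwise]; the approximation error is dominated by g times the norm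
    of phi. *)
Lemma bochner_integral_multiplier (a : nat -> X -> R) (g : X -> R) :
  (forall j, measurable_fun D (a j)) ->
  (forall x, D x -> forall j, 0 <= a j x <= g x) ->
  mu.-integrable D (EFin \o g) ->
  is_bochner_integral mu D (fun x => multiplier w (a ^~ x))
    (multiplier w (fun j => fine (\int[mu]_(x in D) (a j x)%:E))).
Proof.
move=> ma ag ig.
have a0 j x : D x -> (0 <= (a j x)%:E)%E by move=> /ag /(_ j) /andP[].
have mEa j : measurable_fun D (fun x => (a j x)%:E) by apply/measurable_EFinP.
pose h n j : {nnsfun X >-> R} := nnsfun_approx mD (mEa j) n.
have h_le n j x : D x -> h n j x <= a j x.
  move=> Dx; rewrite /h nnsfun_approxE -lee_fin.
  by apply: le_approx => // y Dy; exact: a0.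
have h_cvg j x : D x -> h n j x @[n --> \oo] --> a j x.
  move=> Dx; have := cvg_nnsfun_approx mD (mEa j) (a0 j) Dx.
  by move=> /fine_cvgP[_].
(* Two truncations at once: only the first n coordinates, each replaced by its n-th simple
   approximation from below. *)
pose m n x j := if (j < n)%N then h n j x else 0.
have m_bnd n x j : D x -> 0 <= m n x j <= a j x.
  move=> Dx; rewrite /m; case: ifP => _; first by rewrite fun_ge0 h_le.
  by rewrite lexx -lee_fin a0.
have m_g n x : D x -> forall j, `|m n x j| <= g x.
  move=> Dx j; have /andP[m0 mle] := m_bnd n x j Dx.
  by rewrite ger0_norm// (le_trans mle)//; have /andP[] := ag x Dx j.
have a_g x : D x -> forall j, `|a j x| <= g x.
  by move=> Dx j; have /andP[aj0 ajg] := ag x Dx j; rewrite ger0_norm.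
have m_cvg x j : D x -> m n x j @[n --> \oo] --> a j x.
  move=> Dx; apply: cvg_trans (h_cvg j x Dx); apply: near_eq_cvg.
  by exists j.+1 => // n /= jn; rewrite /m jn.
have mult_m_cvg x : D x -> multiplier w (m n x) @[n --> \oo] --> multiplier w (a ^~ x).
  move=> Dx; apply: (multiplier_cvg_pointwise H_ip w_orth w_cvg _ (C := g x)).
  - by apply: nearW => n; exact: m_g.
  - exact: a_g.
  - by move=> j; exact: m_cvg.
have mult_sub n x : D x -> multiplier w (fun j => a j x - m n x j) =
    multiplier w (a ^~ x) - multiplier w (m n x).
  by move=> Dx; exact: (multiplierB H_ip w_orth w_cvg (a_g x Dx) (m_g n x Dx)).
have [s sP] : exists s : nat -> @simple_map R k H d X mu, forall n,
    (forall x, D x -> sm_fun (s n) x = multiplier w (m n x)) /\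
    sm_integral D (s n) =
      multiplier w (fun j => if (j < n)%N then fine (\int[mu]_(x in D) (h n j x)%:E) else 0).
  have ex n := cid (simple_map_sum mD w (h n) n fD).
  exists (fun n => sval (ex n)) => n; have [s1 s2] := svalP (ex n).
  by split => [x Dx|]; rewrite ?s1 ?s2// multiplier_finite.
exists s; split.
- apply: aeW => x Dx; apply: cvg_trans (mult_m_cvg x Dx).
  by apply: near_eq_cvg; apply: nearW => n; rewrite (sP n).1.
- have [] := @dominated_convergence _ _ R mu D mD
    (fun n x => (rnorm (multiplier w (fun j => a j x - m n x j)))%:E) (cst 0%E)
    (fun x => (rnorm phi)%:E * (g x)%:E)%E.
  + move=> n; apply/measurable_EFinP.
    apply: (measurable_rnorm_multiplier H_ip w_orth w_cvg (C := g)).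
      move=> x Dx j; have /andP[m0 mle] := m_bnd n x j Dx.
      rewrite ger0_norm ?subr_ge0// (le_trans (_ : _ <= a j x)) ?gerBl//.
      by have /andP[] := ag x Dx j.
    move=> j; apply: measurable_funB => //; rewrite /m; case: (j < n)%N => //.
    exact: measurable_funTS.
  + exact: measurable_cst.
  + apply: aeW => x Dx /=; apply: cvg_EFin; first by apply: nearW => n; exact: isT.
    move/cvg_rnorm0P : (mult_m_cvg x Dx); apply: cvg_trans; apply: near_eq_cvg; apply: nearW => n.
    by rewrite /= mult_sub.
  + exact: integrableZl.
  + apply: aeW => x n Dx; rewrite gee0_abs ?lee_fin ?rnorm_ge0// mulrC.
    apply: (rnorm_multiplier_le H_ip w_orth w_cvg) => j.
    have /andP[m0 mle] := m_bnd n x j Dx.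
    rewrite ger0_norm ?subr_ge0// (le_trans (_ : _ <= a j x)) ?gerBl//.
    by have /andP[] := ag x Dx j.
  move=> _ _; rewrite integral0; apply: cvg_trans; apply: near_eq_cvg.
  apply: nearW => n; apply: eq_integral => x /set_mem Dx.
  by rewrite (sP n).1// -mult_sub.
- have int_a j : (\int[mu]_(x in D) (a j x)%:E <= \int[mu]_(x in D) (g x)%:E)%E.
    apply: ge0_le_lower_integral => x Dx; first exact: a0.
    by rewrite lee_fin; have /andP[] := ag x Dx j.
  have g_fin : (\int[mu]_(x in D) (g x)%:E)%E \is a fin_num by exact: integrable_fin_num.
  have a_fin j : (\int[mu]_(x in D) (a j x)%:E)%E \is a fin_num.
    rewrite ge0_fin_numE; last by apply: integral_ge0 => x Dx; exact: a0.
    by rewrite (le_lt_trans (int_a j))// -ge0_fin_numE// (le_trans _ (int_a j))//;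
      apply: integral_ge0 => x Dx; exact: a0.
  have int_h n j : (\int[mu]_(x in D) (h n j x)%:E <= \int[mu]_(x in D) (a j x)%:E)%E.
    apply: ge0_le_lower_integral => x Dx; rewrite lee_fin ?fun_ge0//.
    exact: h_le.
  have h0 n j : (0 <= \int[mu]_(x in D) (h n j x)%:E)%E.
    by apply: integral_ge0 => x Dx; rewrite lee_fin fun_ge0.
  have h_fin n j : (\int[mu]_(x in D) (h n j x)%:E)%E \is a fin_num.
    by rewrite ge0_fin_numE// (le_lt_trans (int_h n j))// -ge0_fin_numE// (le_trans (h0 n j)).
  have -> : (fun n => sm_integral D (s n)) =
      (fun n => multiplier w
        (fun j => if (j < n)%N then fine (\int[mu]_(x in D) (h n j x)%:E) else 0)).
    by apply/funext => n; rewrite (sP n).2.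
  apply: (multiplier_cvg_pointwise H_ip w_orth w_cvg _ (C := fine (\int[mu]_(x in D) (g x)%:E))).
  + apply: nearW => n j; case: ifP => _; last first.
      by rewrite normr0 fine_ge0// (le_trans (h0 n j))// (le_trans (int_h n j)).
    by rewrite ger0_norm ?fine_ge0// fine_le// (le_trans (int_h n j)).
  + by move=> j; rewrite ger0_norm ?fine_ge0 ?fine_le// integral_ge0// => x; exact: a0.
  + move=> j.
    have cv : (\int[mu]_(x in D) (h n j x)%:E @[n --> \oo] --> \int[mu]_(x in D) (a j x)%:E)%E.
      have -> : (\int[mu]_(x in D) (a j x)%:E =
          \int[mu]_(x in D) limn (fun n => (h n j x)%:E))%E.
        apply: eq_integral => x /set_mem Dx; apply/esym/cvg_lim => //.
        by apply: cvg_EFin; [exact: nearW|exact: h_cvg].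
      apply: cvg_monotone_convergence => //.
      * by move=> n; apply/measurable_EFinP; exact: measurable_funTS.
      * by move=> n x _; rewrite lee_fin fun_ge0.
      * move=> x Dx n1 n2 n12; rewrite lee_fin.
        by have /lefP := nd_nnsfun_approx mD (mEa j) n12; exact.
    move: cv; rewrite -(fineK (a_fin j)) => /fine_cvgP[_ cv].
    apply: cvg_trans cv; apply: near_eq_cvg.
    by exists j.+1 => // n /= ->.
Qed.

End bochner_multiplier.

(** * Uniqueness *)

Section punctured_filters.
Context {R : realType} (T t : R).

(** Makes the filter of [derivative_on] proper at every point of ]0, T], including T where only left
    neighbours count, so that its limits are unique. *)
Lemma within_dnbhs_left (t_in : 0 < t <= T) : t^'- `=>` within `]0, T] t^'.
Proof.
move: t_in => /andP[t0 tT] A [d /= d0 dA].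
exists (Num.min d t); first by rewrite /= lt_min d0.
move=> x /= xd xt; apply: dA => /=.
- by rewrite (lt_le_trans xd)// ge_min lexx.
- by rewrite lt_eqF.
- rewrite in_itv/= (le_trans (ltW xt))// andbT.
  move: xd; rewrite gtr0_norm ?subr_gt0// lt_min => /andP[_].
  by rewrite gtrBl.
Qed.

Lemma within_dnbhs_proper (t_in : 0 < t <= T) : ProperFilter (within `]0, T] t^').
Proof.
constructor; last exact: within_filter.
by move=> /(within_dnbhs_left t_in); exact: filter_not_empty.
Qed.

Lemma dnbhs_within_itv (t_in : 0 < t < T) : t^' `=>` within `]0, T] t^'.
Proof.
move: t_in => /andP[t0 tT] A [d /= d0 dA].
exists (Num.min d (Num.min t (T - t))); first by rewrite /= !lt_min d0 t0 subr_gt0.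
move=> x /=; rewrite !lt_min => /and3P[xd xt xT] xnt; apply: dA => //=.
rewrite in_itv/=; move: xt xT; rewrite !ltr_norml => /andP[x1 x2] /andP[x3 x4].
by apply/andP; split; lra.
Qed.

End punctured_filters.

Section solutions.
Context {R : realType} {k : scalar_kind} {H : completeNormedModType (scalars R k)}.
Local Notation K := (scalars R k).
Local Notation "x %:K" := (scalar_of_real k x) (at level 2, format "x %:K").
Local Notation mu := (@lebesgue_measure R).
Variables (ip : {dot H for @scalar_conj R k}) (A : linear_operator H) (v : nat -> H)
  (lambda : nat -> R) (rho T : R).
Hypotheses (H_ip : is_scalar_product ip) (A_sa : self_adjoint ip A)
  (v_on : complete_orthonormal_system ip v)
  (v_dom : forall j, op_dom A (v j))
  (v_eigen : forall j, A (v j) = (lambda j)%:K *: v j)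
  (lambda_gt0 : forall j, 0 < lambda j)
  (rho_gt0 : 0 < rho) (rho_lt1 : rho < 1).

Lemma rip_eigen (x : H) (c : K) j : op_dom A x ->
  rip ip (A x) (c *: v j) = lambda j * rip ip x (c *: v j).
Proof.
move=> Ax; rewrite /rip !ipZr.
have /A_sa.2/(_ x Ax) -> : op_dom A (v j) /\ A (v j) = A (v j) by [].
by rewrite v_eigen ipZr scalar_conj_real mulrCA scalar_re_mull.
Qed.

Lemma frac_integrandE (u : R -> H) (t xi : R) :
  frac_integrand (rho - 1) u t xi = ((t - xi) `^ (- rho))%:K *: u xi.
Proof. by rewrite /frac_integrand subrK powRN. Qed.

Lemma bochner_integralP (d : measure_display) (X : measurableType d)
    (m : {measure set X -> \bar R}) (D : set X) (f : X -> H) :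
  bochner_integrable m D f ->
  is_bochner_integral m D f (bochner_integral m D f).
Proof. by move=> [x fx]; exact: (xgetPex 0 (ex_intro _ x fx)). Qed.

Section weak_form.
Variables (phi : H) (s : R -> H).
Hypothesis s_sol : is_solution A rho T phi s.
Variables (j : nat) (c : K).
Hypothesis c_le1 : rnorm (c *: v j) <= 1.
Let y := c *: v j.
Let z t := rip ip (s t) y.
Let g t := rip ip (frac_integral (rho - 1) s t) y.

(** A solution is not assumed continuous, only A u is. The coordinate of A u is lambda_j times that
    of u, and lambda_j is nonzero. *)
Lemma weak_cvg (t : R) : 0 < t <= T -> z x @[x --> within `]0, T] (nbhs t)] --> z t.
Proof.
move=> tT.
have tin : `]0, T]%classic t by rewrite /= in_itv.
have := sol_op_cont s_sol => /subspace_continuousP /(_ t tin) cA.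
have cv : (lambda j)^-1 * rip ip (A (s x)) y @[x --> within `]0, T] (nbhs t)] -->
    (lambda j)^-1 * rip ip (A (s t)) y.
  by apply: cvgMr; exact: rip_cvg.
have zE x : 0 < x <= T -> (lambda j)^-1 * rip ip (A (s x)) y = z x.
  by move=> xT; rewrite rip_eigen ?mulKf ?gt_eqF//; exact: (sol_dom s_sol).
rewrite -zE//; apply: cvg_trans cv; apply: near_eq_cvg.
by rewrite near_withinE; apply: nearW => x /=; rewrite in_itv/=; exact: zE.
Qed.

Lemma weak_continuous (t : R) : 0 < t < T -> {for t, continuous z}.
Proof.
move=> /andP[t0 tT]; have tT' : 0 < t <= T by rewrite t0 ltW.
have int_t : nbhs t `]0, T]%classic.
  have : t \in `]0, T[ by rewrite in_itv/= t0.
  move=> /near_in_itvoo; apply: filterS => x; rewrite /= !in_itv/= => /andP[-> /ltW //].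
by have := weak_cvg tT'; rewrite within_interior.
Qed.

(** The continuity of z supplies the measurability that [bochner_integral_weak] asks for. *)
Lemma weak_integral (t : R) : 0 < t < T ->
  mu.-integrable `]0, t[ (fun xi => ((t - xi) `^ (- rho) * z xi)%:E) /\
  g t = (Gamma (1 - rho))^-1 * \int[mu]_(xi in `]0, t[) ((t - xi) `^ (- rho) * z xi).
Proof.
move=> /andP[t0 tT]; have tin : `]0, T]%classic t by rewrite /= in_itv/= t0 ltW.
have [fi _] := sol_frac_derivative s_sol tin.
have b := bochner_integralP fi.
have rE xi : rip ip (frac_integrand (rho - 1) s t xi) y = (t - xi) `^ (- rho) * z xi.
  by rewrite frac_integrandE ripZl.
have mf : measurable_fun `]0, t[ (fun xi => rip ip (frac_integrand (rho - 1) s t xi) y).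
  rewrite (_ : (fun xi => _) = (fun xi => (t - xi) `^ (- rho) * z xi)); last first.
    by apply/funext => xi; exact: rE.
  apply: measurable_funM.
    apply: measurable_funTS; apply: (measurableT_comp (measurable_powR _)).
    exact: measurable_funB.
  apply: open_continuous_measurable_fun => // x; rewrite inE/= in_itv/= => /andP[x0 xt].
  by apply: weak_continuous; rewrite x0 (lt_trans xt).
have [||b1 b2] := bochner_integral_weak _ H_ip b c_le1.
- exact: measurable_itv.
- exact: mf.
split; first by apply: eq_integrable b1 => // xi _; rewrite rE.
rewrite /g /frac_integral ripZl opprB; congr (_ * _).
rewrite /Rintegral (_ : (\int[mu]_(x in _) _)%E = (rip ip (bochner_integral mu `]0, t[
  (frac_integrand (rho - 1) s t)) y)%:E)// -b2.
by apply: eq_integral => xi _; rewrite rE.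
Qed.

Lemma weak_derive (t : R) : 0 < t < T -> is_derive t 1 g (- (lambda j * z t)).
Proof.
move=> tT; have /andP[t0 t1] := tT.
have tT' : 0 < t <= T by rewrite t0 ltW.
have tin : `]0, T]%classic t by rewrite /= in_itv.
have [_ dF] := sol_frac_derivative s_sol tin.
have PF := within_dnbhs_proper tT'.
have eq0 := sol_equation s_sol tT'.
have dv : frac_derivative `]0, T] rho s t = - A (s t).
  by apply/eqP; rewrite -addr_eq0 eq0.
have cv : diff_quotient (frac_integral (rho - 1) s) t @ t^' --> - A (s t).
  rewrite -dv; apply: cvg_trans dF; apply: cvg_app.
  exact: dnbhs_within_itv.
have shift : (fun h : R => h *: (1 : R) + t) @ 0^' --> t^'.
  move=> B [d /= d0 dB]; exists d => // h /=; rewrite sub0r normrN => hd h0.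
  apply: dB => /=.
    by rewrite opprD addrCA subrr addr0 normrN /GRing.scale/= mulr1.
  by rewrite /GRing.scale/= mulr1 -subr_eq0 addrK.
have dE : - (lambda j * z t) = rip ip (- A (s t)) y.
  by rewrite ripNl rip_eigen//; exact: (sol_dom s_sol).
have cv2 : rip ip (diff_quotient (frac_integral (rho - 1) s) t x) y @[x --> t^'] -->
    rip ip (- A (s t)) y by exact: rip_cvg.
have cvg_h : h^-1 *: (g (h *: (1 : R) + t) - g t) @[h --> 0^'] --> - (lambda j * z t).
  rewrite dE; have cv3 := @cvg_comp _ _ _ _ (fun x =>
    rip ip (diff_quotient (frac_integral (rho - 1) s) t x) y) _ _ _ shift cv2.
  apply: cvg_trans cv3.
  apply: near_eq_cvg; apply: nearW => h /=.
  by rewrite /diff_quotient ripZl ripBl addrK [X in X^-1]/GRing.scale/= mulr1.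
by split; [apply/cvg_ex; exists (- (lambda j * z t))|exact/cvg_lim].
Qed.

Lemma weak_initial : g t @[t --> (0:R)^'+] --> rip ip phi y.
Proof. by apply: rip_cvg => //; exact: (sol_initial s_sol). Qed.

End weak_form.

(** The coordinates z and g of the difference satisfy the hypotheses of [frac_uniqueness], which
    works on the open interval where derivatives are two-sided. *)
Lemma solution_unique (phi : H) (s1 s2 : R -> H) :
  is_solution A rho T phi s1 -> is_solution A rho T phi s2 ->
  forall t, 0 < t <= T -> s1 t = s2 t.
Proof.
move=> sol1 sol2 t tT; apply/eqP; rewrite -subr_eq0; apply/eqP.
apply: (rip_eq0_all H_ip v_on) => j c c1.
have c0 : 0 < (Gamma (1 - rho))^-1 :> R by rewrite invr_gt0 Gamma_gt0// subr_gt0.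
pose z x := rip ip (s1 x) (c *: v j) - rip ip (s2 x) (c *: v j).
pose g x := rip ip (frac_integral (rho - 1) s1 x) (c *: v j) -
            rip ip (frac_integral (rho - 1) s2 x) (c *: v j).
have z0 : forall x, 0 < x < T -> z x = 0.
  apply: (frac_uniqueness rho_gt0 rho_lt1 (lambda_gt0 j) c0 (z := z) (g := g)).
  - move=> x xT; rewrite /continuous_at /z; apply: cvgB.
      exact: (@weak_continuous phi s1 sol1 j c x xT).
    exact: (@weak_continuous phi s2 sol2 j c x xT).
  - move=> x xT.
    have := @integrableB _ _ _ mu `]0, x[%classic (measurable_itv _) _ _
      (weak_integral sol1 c1 xT).1 (weak_integral sol2 c1 xT).1.
    by apply: eq_integrable => // xi _; rewrite /= -EFinB -mulrBr.
  - move=> x xT; rewrite /g (weak_integral sol1 c1 xT).2 (weak_integral sol2 c1 xT).2.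
    rewrite -mulrBr -RintegralB//; last 2 first.
    + exact: (weak_integral sol1 c1 xT).1.
    + exact: (weak_integral sol2 c1 xT).1.
    by congr (_ * _); apply: eq_Rintegral => xi _; rewrite -mulrBr.
  - move=> x xT.
    have d1 := @weak_derive phi s1 sol1 j c x xT; have d2 := @weak_derive phi s2 sol2 j c x xT.
    by apply: (is_derive_eq (is_deriveB d1 d2)); rewrite /z; ring.
  - rewrite -[X in _ --> X](subrr (rip ip phi (c *: v j))).
    by apply: cvgB; [exact: (@weak_initial phi s1 sol1 j c)|exact: (@weak_initial phi s2 sol2 j c)].
rewrite ripBl -/(z t); have [tlt|tge] := ltP t T.
  by apply: z0; rewrite tlt andbT; case/andP: tT.
(* The remaining case is t = T: z vanishes to the left of T and is continuous at T within ]0, T]. *)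
have zc : z x @[x --> within `]0, T] (nbhs t)] --> z t.
  by apply: cvgB; [exact: (@weak_cvg phi s1 sol1 j c t tT)|exact: (@weak_cvg phi s2 sol2 j c t tT)].
have zc' : z x @[x --> t^'-] --> z t.
  apply: cvg_trans zc; apply: cvg_app => B [d /= d0 dB].
  have t0 : 0 < t by case/andP: tT.
  exists (Num.min d t); first by rewrite /= lt_min d0.
  move=> x /= xd xt; apply: dB => /=; first by rewrite (lt_le_trans xd)// ge_min lexx.
  rewrite in_itv/= (le_trans (ltW xt)) ?andbT; last by case/andP: tT.
  by move: xd; rewrite gtr0_norm ?subr_gt0// lt_min gtrBl => /andP[].
have [t0 tleT] : 0 < t /\ t <= T by apply/andP.
have zc0 : z x @[x --> t^'-] --> (0:R).
  apply: cvg_near_cst; near=> x; apply: z0; apply/andP; split.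
    by near: x; exact: nbhs_left_gt.
  by apply: lt_le_trans tleT; near: x; exact: nbhs_left_lt.
by rewrite -(cvg_lim _ zc')// (cvg_lim _ zc0).
Unshelve. all: by end_near. Qed.

End solutions.

(** * Existence *)

Lemma is_bochner_integral_eq (R : realType) (k : scalar_kind)
    (H : completeNormedModType (scalars R k)) (d : measure_display)
    (X : measurableType d) (mu : {measure set X -> \bar R}) (D : set X)
    (f f' : X -> H) (u : H) : (forall x, D x -> f x = f' x) ->
  is_bochner_integral mu D f u -> is_bochner_integral mu D f' u.
Proof.
move=> ff' [s [s1 s2 s3]]; exists s; split => //.
  by apply: filterS s1 => x + Dx; rewrite -ff'//; exact.
apply: cvg_trans s2; apply: near_eq_cvg; apply: nearW => n.
by apply: eq_integral => x /set_mem Dx; rewrite ff'.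
Qed.

Section existence.
Context {R : realType} {k : scalar_kind} {H : completeNormedModType (scalars R k)}.
Local Notation K := (scalars R k).
Local Notation "x %:K" := (scalar_of_real k x) (at level 2, format "x %:K").
Local Notation mu := (@lebesgue_measure R).
Variables (ip : {dot H for @scalar_conj R k}) (A : linear_operator H) (v : nat -> H)
  (lambda : nat -> R) (rho T : R) (phi : H).
Hypotheses (H_ip : is_scalar_product ip) (A_sa : self_adjoint ip A)
  (v_on : complete_orthonormal_system ip v)
  (v_dom : forall j, op_dom A (v j))
  (v_eigen : forall j, A (v j) = (lambda j)%:K *: v j)
  (lambda_gt0 : forall j, 0 < lambda j)
  (rho_gt0 : 0 < rho) (rho_lt1 : rho < 1).

Local Notation w := (fourier_term ip v phi).
Local Notation e j := (mlk rho rho (lambda j)).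
Local Notation E j := (mlk rho 1 (lambda j)).

Let w_orth i j : i != j -> rip ip (w i) (w j) = 0.
Proof. exact: rip_fourier_term_orth. Qed.

Let w_cvg : series w @ \oo --> phi.
Proof. exact: expansion_cvg. Qed.

Definition fourier_sol (t : R) : H := multiplier w (fun j => e j t).
Definition fourier_sol_op (t : R) : H := multiplier w (fun j => lambda j * e j t).
Definition fourier_sol_int (t : R) : H := multiplier w (fun j => E j t).

Lemma norm_mlk_le (t : R) : 0 < t -> forall j, `|e j t| <= t `^ (rho - 1) / Gamma rho.
Proof.
move=> t0 j; rewrite ger0_norm; first exact: mlk_le_powR.
by rewrite ltW// mlk_gt0.
Qed.

Lemma norm_lambda_mlk_le (t : R) : 0 < t -> forall j, `|lambda j * e j t| <= t^-1.
Proof.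
move=> t0 j; rewrite ger0_norm; first exact: mlk_decay.
by rewrite mulr_ge0 ?ltW// mlk_gt0.
Qed.

Lemma norm_mlk1_le (t : R) : 0 < t -> forall j, `|E j t| <= 1.
Proof. by move=> t0 j; rewrite ger0_norm ?mlk1_le1 ?mlk1_ge0. Qed.

(** The domain of A is stable under scalars, so the real identity also holds at c x; taking for c
    the conjugate of the defect z yields its squared modulus. *)
Lemma adjoint_graph_rip (u u' : H) :
  (forall x, op_dom A x -> rip ip (A x) u = rip ip x u') -> adjoint_graph ip A u u'.
Proof.
move=> h x Ax; apply/eqP; rewrite -subr_eq0; set z := _ - _.
have hc (c : K) : scalar_re k (c * z) = 0.
  have Acx : op_dom A (c *: x).
    by have := op_dom_lin c Ax (op_dom0 A); rewrite addr0.
  have AcE : A (c *: x) = c *: A x.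
    have A0 : A 0 = 0.
      have := op_fun_lin 1 (op_dom0 A) (op_dom0 A); rewrite !scale1r addr0.
      by move=> /(congr1 (fun y => y - A 0)); rewrite subrr addrK.
    by have := op_fun_lin c Ax (op_dom0 A); rewrite A0 !addr0.
  have := h _ Acx; rewrite AcE /rip !ipZl => hx.
  by rewrite /z mulrBr scalar_reD scalar_reN hx subrr.
have := hc (scalar_conj k z); rewrite mulrC scalar_re_normM => /eqP.
rewrite sqrf_eq0 => /eqP z0.
by rewrite -normr_eq0 -(@scalar_reK R k `|z|)// z0 scalar_of_real0.
Qed.

(** Membership in the domain comes from A being equal to its adjoint: it suffices to test against x
    in the domain, where the identity holds for the partial sums and passes to the limit. *)
Lemma fourier_sol_dom (t : R) : 0 < t ->
  op_dom A (fourier_sol t) /\ A (fourier_sol t) = fourier_sol_op t.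
Proof.
move=> t0; suff /A_sa.2 [? ->] : adjoint_graph ip A (fourier_sol t) (fourier_sol_op t) by [].
apply: adjoint_graph_rip => x Ax.
have c1 := multiplier_cvg H_ip w_orth w_cvg (norm_mlk_le t0).
have c2 := multiplier_cvg H_ip w_orth w_cvg (norm_lambda_mlk_le t0).
have c1' : rip ip (series (fun j => (e j t)%:K *: w j) n) (A x) @[n --> \oo] -->
    rip ip (fourier_sol t) (A x) by exact: rip_cvg.
have c2' : rip ip (series (fun j => (lambda j * e j t)%:K *: w j) n) x @[n --> \oo] -->
    rip ip (fourier_sol_op t) x by exact: rip_cvg.
rewrite ripC [RHS]ripC -(cvg_lim _ c2')//; apply/esym/cvg_lim => //.
apply: cvg_trans c1'; apply: near_eq_cvg; apply: nearW => n.
rewrite !rip_suml; apply: eq_bigr => j _.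
rewrite !ripZl ripC /fourier_term (rip_eigen A_sa v_dom v_eigen)//.
by rewrite ripC mulrCA mulrA.
Qed.

Lemma measurable_rip_multiplier (d : measure_display) (X : measurableType d) (D : set X)
    (m : X -> nat -> R) (C : X -> R) (y : H) :
  (forall x, D x -> forall j, `|m x j| <= C x) ->
  (forall j, measurable_fun D (fun x => m x j)) ->
  measurable_fun D (fun x => rip ip (multiplier w (m x)) y).
Proof.
move=> mC mm; apply: (@measurable_fun_cvg _ _ _ _ (fun n x =>
    rip ip (series (fun j => (m x j)%:K *: w j) n) y)); last first.
  by move=> x Dx; apply: rip_cvg => //; apply: (multiplier_cvg H_ip w_orth w_cvg (mC x Dx)).
move=> n; rewrite (_ : (fun x => _) =
    (fun x => \sum_(0 <= j < n) m x j * rip ip (w j) y)); last first.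
  by apply/funext => x; rewrite rip_suml; apply: eq_bigr => j _; rewrite ripZl.
by apply: measurable_sum => j; exact: measurable_funM.
Qed.

Lemma frac_integral_fourier_sol (t : R) : 0 < t ->
  frac_integrable (rho - 1) fourier_sol t /\
  frac_integral (rho - 1) fourier_sol t = fourier_sol_int t.
Proof.
move=> t0; have r0 : 0 < 1 - rho by rewrite subr_gt0.
pose a j xi := (t - xi) `^ (- rho) * e j xi.
(* The majorant of e from [mlk_le_powR], common to all eigenvalues; its integral against (t - xi)^(-
   rho) is a finite Beta integral. *)
pose g xi := (Gamma rho)^-1 * conv_powR (1 - rho) rho t xi.
have ma j : measurable_fun `]0, t[ (a j).
  apply: measurable_funM; last exact: measurable_mlk.
  apply: measurable_funTS; apply: (measurableT_comp (measurable_powR _)).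
  exact: measurable_funB.
have ag xi : `]0, t[%classic xi -> forall j, 0 <= a j xi <= g xi.
  rewrite /= in_itv/= => /andP[x0 xt] j; apply/andP; split.
    by rewrite mulr_ge0 ?powR_ge0// ltW// mlk_gt0.
  rewrite /a /g /conv_powR (_ : 1 - rho - 1 = - rho); last by ring.
  by rewrite [leRHS]mulrCA ler_wpM2l ?powR_ge0// mulrC; exact: mlk_le_powR.
have a_norm xi : `]0, t[%classic xi -> forall j, `|a j xi| <= g xi.
  by move=> xin j; have /andP[a0 a1] := ag xi xin j; rewrite ger0_norm.
have ig : mu.-integrable `]0, t[ (EFin \o g).
  have ic : mu.-integrable `]0, t[ (EFin \o conv_powR (1 - rho) rho t).
    apply/integrableP; split; first by apply/measurable_EFinP; exact: measurable_conv_powR.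
    under eq_integral do rewrite gee0_abs ?lee_fin ?conv_powR_ge0//.
    by rewrite integral_conv_powR// ltry.
  have : mu.-integrable `]0, t[ (fun xi => (Gamma rho)^-1%:E * (conv_powR (1 - rho) rho t xi)%:E)%E.
    by apply: integrableZl => //; exact: measurable_itv.
  by apply: eq_integrable => // xi _; rewrite /= EFinM.
have fD : (mu `]0%R, t[%classic < +oo)%E.
  by rewrite lebesgue_measure_itv/= lte_fin t0 -EFinD ltry.
have bi0 : is_bochner_integral mu `]0, t[ (fun xi => multiplier w (a ^~ xi))
    (multiplier w (fun j => fine (\int[mu]_(xi in `]0%R, t[) (a j xi)%:E)))%E.
  by apply: (bochner_integral_multiplier _ fD H_ip w_orth w_cvg ma ag ig); exact: measurable_itv.
have aE j : fine (\int[mu]_(xi in `]0%R, t[) (a j xi)%:E) = Gamma (1 - rho) * E j t.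
  by rewrite /a (frac_conv_mlk (lambda j) rho_gt0 rho_lt1 t0).2.
have bi : is_bochner_integral mu `]0, t[ (frac_integrand (rho - 1) fourier_sol t)
    (multiplier w (fun j => Gamma (1 - rho) * E j t)).
  rewrite (_ : (fun j => Gamma (1 - rho) * E j t) =
    (fun j => fine (\int[mu]_(xi in `]0%R, t[) (a j xi)%:E))); last first.
    by apply/funext => j; rewrite aE.
  apply: is_bochner_integral_eq bi0 => xi; rewrite /= in_itv/= => /andP[x0 xt].
  rewrite frac_integrandE /fourier_sol -(multiplierZ H_ip w_orth w_cvg _ (norm_mlk_le x0)).
  done.
have fi : frac_integrable (rho - 1) fourier_sol t.
  by exists (multiplier w (fun j => Gamma (1 - rho) * E j t)).
split => //.
have -> : frac_integral (rho - 1) fourier_sol t =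
    (Gamma (1 - rho))^-1%:K *: multiplier w (fun j => Gamma (1 - rho) * E j t).
  rewrite /frac_integral opprB; congr (_ *: _).
  (* The chosen value of the integral and the computed one are limits along possibly different
     simple maps; they agree because their coordinates are the same Lebesgue integrals. *)
  apply/eqP; rewrite -subr_eq0; apply/eqP; apply: (rip_eq0_all H_ip v_on) => j c c1.
  have mf : measurable_fun `]0, t[
      (fun xi => rip ip (frac_integrand (rho - 1) fourier_sol t xi) (c *: v j)).
    apply: (eq_measurable_fun (fun xi => rip ip (multiplier w (a ^~ xi)) (c *: v j))).
      move=> xi /set_mem; rewrite /= in_itv/= => /andP[x0 xt].
      rewrite frac_integrandE /fourier_sol -(multiplierZ H_ip w_orth w_cvg _ (norm_mlk_le x0)).
      done.
    exact: (measurable_rip_multiplier _ a_norm ma).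
  have [||_ e1] := bochner_integral_weak _ H_ip (bochner_integralP fi) c1.
  - exact: measurable_itv.
  - exact: mf.
  have [||_ e2] := bochner_integral_weak _ H_ip bi c1.
  - exact: measurable_itv.
  - exact: mf.
  by move: e1; rewrite e2 => -[e12]; rewrite ripBl e12 subrr.
rewrite (multiplierZ H_ip w_orth w_cvg _ (norm_mlk1_le t0)) scalerA -scalar_of_realM.
by rewrite mulVf ?gt_eqF ?Gamma_gt0// scalar_of_real1 scale1r.
Qed.

(** The derivative of E is - lambda e, which [mlk_decay] bounds by 1 / d on [d, oo[. The constant
    does not depend on j. *)
Lemma mlk1_lipschitz j (x y d : R) : 0 < d -> d <= x -> d <= y ->
  `|E j y - E j x| <= d^-1 * `|y - x|.
Proof.
move=> d0; wlog xy : x y / x < y.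
  move=> h dx dy; have [xy|yx|->] := ltgtP x y.
  - exact: h.
  - by rewrite distrC (distrC y); exact: h.
  - by rewrite !subrr normr0 mulr0.
move=> dx _; have x0 : 0 < x := lt_le_trans d0 dx.
have [c||c + ->] := @MVT R (E j) (fun c => - (lambda j * e j c)) x y xy.
- rewrite in_itv/= => /andP[xc _]; apply: is_derive_mlk1 => //; exact: lt_trans xc.
- apply: continuous_in_subspaceT => z /set_mem; rewrite /= in_itv/= => /andP[xz _].
  apply: mlk_continuous => //; exact: lt_le_trans xz.
rewrite in_itv/= => /andP[xc _]; have c0 := lt_trans x0 xc.
rewrite normrM ler_wpM2r// normrN (le_trans (norm_lambda_mlk_le c0 j))//.
by rewrite lef_pV2// ?posrE// (le_trans dx)// ltW.
Qed.

Lemma mlk1_quotient_cvg j (t : R) : 0 < t ->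
  (s - t)^-1 * (E j s - E j t) @[s --> t^'] --> - (lambda j * e j t).
Proof.
move=> t0; have dE := is_derive_mlk1 rho_gt0 (lambda_gt0 j) t0.
have shift : (fun s : R => s - t) @ t^' --> (0:R)^'.
  move=> B [d /= d0 dB]; exists d => // s /= sd st; apply: dB => /=.
    by rewrite sub0r normrN distrC.
  by rewrite subr_eq0.
have dc : h^-1 *: (E j (h *: (1 : R) + t) - E j t) @[h --> (0:R)^'] --> - (lambda j * e j t).
  rewrite -(@derive_val _ _ _ _ _ _ _ dE); exact: (@ex_derive _ _ _ _ _ _ _ dE).
have := @cvg_comp _ _ _ _ (fun h => h^-1 *: (E j (h *: (1 : R) + t) - E j t)) _ _ _ shift dc.
apply: cvg_trans; apply: near_eq_cvg; apply: nearW => s /=.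
by rewrite /GRing.scale/= mulr1 subrK.
Qed.

Lemma near_gt_half (t : R) : 0 < t -> \forall s \near t, t / 2 < s.
Proof. by move=> t0; apply: lt_nbhsr; rewrite ltr_pdivrMr// mulr_natr mulr2n ltrDl. Qed.

Lemma fourier_sol_op_continuous (t : R) : 0 < t -> {for t, continuous fourier_sol_op}.
Proof.
move=> t0; have t2 : 0 < t / 2 by rewrite divr_gt0.
(* Near t all points exceed t / 2, which turns the bound 1 / s into a constant. *)
apply: (multiplier_cvg_pointwise H_ip w_orth w_cvg _ (C := (t / 2)^-1)).
- apply: filterS (near_gt_half t0) => s ts j; have s0 := lt_trans t2 ts.
  by rewrite (le_trans (norm_lambda_mlk_le s0 j))// lef_pV2// ltW.
- move=> j; rewrite (le_trans (norm_lambda_mlk_le t0 j))// lef_pV2// ?posrE//.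
  by rewrite ler_pdivrMr// mulr_natr mulr2n lerDl ltW.
- by move=> j; apply: cvgMr; apply: mlk_continuous.
Qed.

(** Differentiation under the sum: the quotients of the E_j are bounded by 2 / t for all j by
    [mlk1_lipschitz] and converge for each j. *)
Lemma diff_quotient_fourier_sol_int (t : R) : 0 < t ->
  diff_quotient fourier_sol_int t s @[s --> t^'] --> - fourier_sol_op t.
Proof.
move=> t0; have t2 : 0 < t / 2 by rewrite divr_gt0.
have tt2 : t / 2 <= t by rewrite ler_pdivrMr// mulr_natr mulr2n lerDl ltW.
have -> : - fourier_sol_op t = multiplier w (fun j => - (lambda j * e j t)).
  rewrite (_ : (fun j => - _) = (fun j => -1 * (lambda j * e j t))); last first.
    by apply/funext => j; rewrite mulN1r.
  rewrite (multiplierZ H_ip w_orth w_cvg _ (norm_lambda_mlk_le t0)).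
  by rewrite -scaleN1r scalar_of_realN scalar_of_real1.
have near2 : \forall s \near t^', t / 2 < s by apply: nbhs_dnbhs; exact: near_gt_half.
have bnd s : t / 2 < s -> forall j, `|(s - t)^-1 * (E j s - E j t)| <= (t / 2)^-1.
  move=> ts j; have [->|st] := eqVneq s t.
    by rewrite !subrr mulr0 normr0 invr_ge0 ltW.
  rewrite normrM normfV mulrC ler_pdivrMr ?normr_gt0 ?subr_eq0//.
  by apply: mlk1_lipschitz => //; exact: ltW.
have mcvg : multiplier w (fun j => (s - t)^-1 * (E j s - E j t)) @[s --> t^'] -->
    multiplier w (fun j => - (lambda j * e j t)).
  apply: (multiplier_cvg_pointwise H_ip w_orth w_cvg _ (C := (t / 2)^-1)).
  - exact: filterS bnd near2.
  - by move=> j; rewrite normrN (le_trans (norm_lambda_mlk_le t0 j))// lef_pV2.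
  - by move=> j; exact: mlk1_quotient_cvg.
apply: cvg_trans mcvg; apply: near_eq_cvg; apply: filterS near2 => s ts; have s0 := lt_trans t2 ts.
rewrite /diff_quotient /fourier_sol_int.
rewrite -(multiplierB H_ip w_orth w_cvg (norm_mlk1_le s0) (norm_mlk1_le t0)).
rewrite -(multiplierZ H_ip w_orth w_cvg _ (C := (1 + 1)))// => j.
by rewrite (le_trans (ler_normB _ _))// lerD// norm_mlk1_le.
Qed.

Lemma fourier_sol_int_cvg0 : fourier_sol_int t @[t --> (0:R)^'+] --> phi.
Proof.
rewrite -[X in _ --> X](multiplier1 w_cvg).
apply: (multiplier_cvg_pointwise H_ip w_orth w_cvg _ (C := 1)).
- by near=> t => j; apply: norm_mlk1_le; near: t; exact: nbhs_right_gt.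
- by move=> j; rewrite normr1.
- by move=> j; exact: mlk1_cvg0.
Unshelve. all: by end_near. Qed.

Lemma diff_quotient_fourier_sol (t : R) : 0 < t <= T ->
  diff_quotient (frac_integral (rho - 1) fourier_sol) t @ within `]0, T] t^' --> - fourier_sol_op t.
Proof.
move=> /andP[t0 tT].
apply: cvg_trans (cvg_trans (cvg_app _ (@cvg_within _ _ _ _)) (diff_quotient_fourier_sol_int t0)).
apply: near_eq_cvg; rewrite near_withinE; apply: nearW => s.
rewrite /= in_itv/= => /andP[s0 _].
by rewrite /diff_quotient (frac_integral_fourier_sol s0).2 (frac_integral_fourier_sol t0).2.
Qed.

Lemma frac_derivative_fourier_sol (t : R) : 0 < t <= T ->
  frac_derivative `]0, T] rho fourier_sol t = - fourier_sol_op t.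
Proof.
move=> tT; have PF := within_dnbhs_proper tT.
by apply: cvg_lim => //; exact: diff_quotient_fourier_sol.
Qed.

Lemma fourier_sol_is_solution : is_solution A rho T phi fourier_sol.
Proof.
have inT (t : R) : `]0, T]%classic t -> 0 < t <= T by rewrite /= in_itv.
have A_cont : {within `]0, T], continuous fourier_sol_op}.
  apply: continuous_in_subspaceT => t /set_mem/inT/andP[t0 _].
  exact: fourier_sol_op_continuous.
split.
- move=> t /inT tT; split; last first.
    by apply/cvg_ex; exists (- fourier_sol_op t); exact: diff_quotient_fourier_sol.
  by have /andP[t0 _] := tT; exact: (frac_integral_fourier_sol t0).1.
- apply: (@subspace_eq_continuous _ _ _ (fun t => - fourier_sol_op t)).
    by move=> t /set_mem/inT tT; exact/esym/frac_derivative_fourier_sol.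
  by move=> t; apply: cvgN; exact: A_cont.
- by move=> t /andP[t0 _]; exact: (fourier_sol_dom t0).1.
- apply: (@subspace_eq_continuous _ _ _ fourier_sol_op) => //.
  by move=> t /set_mem/inT/andP[t0 _]; exact/esym/(fourier_sol_dom t0).2.
- move=> t tT; rewrite frac_derivative_fourier_sol//.
  by have /andP[t0 _] := tT; rewrite (fourier_sol_dom t0).2 addNr.
- apply: cvg_trans fourier_sol_int_cvg0; apply: near_eq_cvg; near=> t.
  have t0 : 0 < t by near: t; exact: nbhs_right_gt.
  by rewrite (frac_integral_fourier_sol t0).2.
Unshelve. all: by end_near. Qed.

Lemma fourier_sol_series (t : R) : 0 < t ->
  series (fun j => ((t `^ (rho - 1) * mittag_leffler rho rho (- lambda j * t `^ rho))%:K
    * ip phi (v j)) *: v j) @ \oo --> fourier_sol t.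
Proof.
move=> t0; rewrite (_ : (fun j => _) = (fun j => (e j t)%:K *: w j)); last first.
  by apply/funext => j; rewrite scalerA.
exact: (multiplier_cvg H_ip w_orth w_cvg (norm_mlk_le t0)).
Qed.

End existence.

Theorem theorem1p2 (R : realType) (k : scalar_kind)
    (H : completeNormedModType (scalars R k))
    (ip : {dot H for scalar_conj k})
    (A : linear_operator H) (v : nat -> H) (lambda : nat -> R) (rho T : R)
    (H_ip : is_scalar_product ip) (H_sep : separable_space H)
    (A_pos : positive_operator ip A) (A_sa : self_adjoint ip A)
    (v_complete : complete_orthonormal_system ip v)
    (v_dom : forall j, op_dom A (v j))
    (v_eigen : forall j, A (v j) = scalar_of_real k (lambda j) *: v j)
    (lambda_gt0 : 0 < lambda 0%N)
    (lambda_mono : forall j, lambda j <= lambda j.+1)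
    (rho_gt0 : 0 < rho) (rho_lt1 : rho < 1) (T_gt0 : 0 < T) (phi : H) :
  exists u : R -> H,
    [/\ is_solution A rho T phi u,
        forall w : R -> H, is_solution A rho T phi w ->
          forall t : R, 0 < t <= T -> w t = u t
      & forall t : R, 0 < t <= T ->
          series (fun j : nat =>
            (scalar_of_real k
               (t `^ (rho - 1) * mittag_leffler rho rho (- lambda j * t `^ rho))
             * ip phi (v j)) *: v j) @ \oo --> u t].
Proof.
have lambda_pos j : 0 < lambda j.
  by elim: j => // j lt0; exact: lt_le_trans (lambda_mono j).
have u_sol := fourier_sol_is_solution T phi H_ip A_sa v_complete v_dom v_eigen lambda_pos
  rho_gt0 rho_lt1.
exists (fourier_sol ip v lambda rho phi); split => //.
- move=> w w_sol t tT.
  exact: (solution_unique H_ip A_sa v_complete v_dom v_eigen lambda_pos rho_gt0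
    rho_lt1 w_sol u_sol tT).
- by move=> t /andP[t0 _]; exact: fourier_sol_series.
Qed.
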